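(* Let $(\mathcal{A},\tau)$ be a tracial $W^\star$-probability space with unit ${\bf 1}$, let $P,Q\in\mathcal{A}$ be orthogonal projections with $\tau(P)=\tau(Q)=1/2$, and let $(U_t)_{t\ge0}$ in $\mathcal{A}$ be a free unitary Brownian motion (with $U_0={\bf 1}$) which is $\star$-free from $\{P,Q\}$. Set $R:=2P-{\bf 1}$, $S:=2Q-{\bf 1}$, and let $W_{2t}:=RS\,U_{2t}$ (the free unitary Brownian motion at time $2t$ started at $RS$). Then for any $t>0$, the square $C_t^2$ of the commutator $$C_t:=i\,(PU_tQU_t^{\star}-U_tQU_t^{\star}P)$$ has the same spectral distribution (with respect to $\tau$) as $$\frac{[2{\bf 1}+W_{2t}+W_{2t}^{\star}]\,[2{\bf 1}-(W_{2t}+W_{2t}^{\star})]}{16}.$$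
   Context: A tracial $W^\star$-probability space is a von Neumann algebra $\mathcal{A}$ with a faithful normal tracial state $\tau$. An orthogonal projection is an element $P=P^\star=P^2$. The free unitary Brownian motion $(U_t)_{t\ge0}$ is the unitary process with $U_0={\bf 1}$ solving the free stochastic differential equation $dU_t=i\,dX_t\,U_t-\tfrac12U_t\,dt$, where $(X_t)_{t\ge0}$ is a free additive (semicircular) Brownian motion with $\tau(X_t^2)=t$; it has free, stationary multiplicative increments. The spectral distribution of a self-adjoint element $a$ is the probability measure $\mu$ on $\mathbb{R}$ with $\tau(a^n)=\int x^n\,\mu(dx)$ for all $n\ge0$. The element $\star$-freeness is freeness in the sense of Voiculescu. *)

(* Defs.v *)
From HB Require Import structures.
From mathcomp Require Import all_boot all_order all_algebra.
From mathcomp Require Import sesquilinear complex.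
From mathcomp Require Import all_classical all_reals all_analysis.

Set Implicit Arguments.
Unset Strict Implicit.
Unset Printing Implicit Defensive.

Import Order.TTheory GRing.Theory Num.Theory.
Import numFieldNormedType.Exports.

Local Open Scope classical_set_scope.
Local Open Scope complex_scope.
Local Open Scope ring_scope.

(* [inner] is linear in its first argument and conjugate-linear in the        *)
(* second; completeness comes from [completeNormedModType].                   *)
Record hilbertSpace (R : realType) := HilbertSpace {
  hs_sort :> completeNormedModType R[i] ;
  inner : {dot hs_sort for (Num.conj : R[i] -> R[i])} ;
  inner_norm : forall x : hs_sort, inner x x = `|x| ^+ 2 }.

Definition bounded_operator (R : realType) (H : hilbertSpace R)
    (T : {linear H -> H}) :=
  exists M : R[i], forall x : H, `|T x| <= M * `|x|.

(* Closure in the weak operator topology: the sets                            *)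
(* [{T' | |<(T' - T) x, y>| < e for all (x, y) in s}], with s a finite list,  *)
(* are a basis of neighbourhoods of T.                                        *)
Definition wot_closure (R : realType) (H : hilbertSpace R)
    (B : set {linear H -> H}) : set {linear H -> H} :=
  [set T | forall (e : R) (s : seq (H * H)), 0 < e ->
     exists2 T', B T' &
       forall p, p \in s -> `|inner H (T' p.1 - T p.1) p.2| < e%:C].

(* A von Neumann algebra of operators on the Hilbert space [vn_space]: the    *)
(* carrier is an abstract algebra, identified by the faithful unital          *)
(* star-representation [act] with a weakly closed algebra of operators.       *)
Record vonNeumannAlgebra (R : realType) := VonNeumannAlgebra {
  vn_sort :> algType R[i] ;
  vn_space : hilbertSpace R ;
  star : vn_sort -> vn_sort ;
  act : vn_sort -> {linear vn_space -> vn_space} ;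
  act_bounded : forall a, bounded_operator (act a) ;
  act1 : forall x, act 1 x = x ;
  actD : forall a b x, act (a + b) x = act a x + act b x ;
  actZ : forall (c : R[i]) a x, act (c *: a) x = c *: act a x ;
  actM : forall a b x, act (a * b) x = act a (act b x) ;
  act_star : forall a x y,
    inner vn_space (act a x) y = inner vn_space x (act (star a) y) ;
  act_inj : forall a b, act a =1 act b -> a = b ;
  act_closed : forall T, bounded_operator T -> wot_closure (range act) T ->
    exists a, act a =1 T }.
Arguments star {R v} a.
Arguments act {R v} a.

Section Algebra.
Context {R : realType} {A : vonNeumannAlgebra R}.
Implicit Types (a b : A) (B D : set A).

Definition self_adjoint a := star a = a.

Definition orthogonal_projection a := star a = a /\ a * a = a.

Definition unitary a := star a * a = 1 /\ a * star a = 1.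

Definition vn_pos a := forall x, 0 <= inner (vn_space A) (act a x) x.

Definition vn_le a b := vn_pos (b - a).

Definition vn_directed D := D !=set0 /\
  forall a b, D a -> D b -> exists2 c, D c & vn_le a c /\ vn_le b c.

Definition vn_is_lub D a := (forall d, D d -> vn_le d a) /\
  forall b, (forall d, D d -> vn_le d b) -> vn_le a b.

Definition star_subalgebra B :=
  [/\ B 1,
      forall a b, B a -> B b -> B (a + b),
      forall (c : R[i]) a, B a -> B (c *: a),
      forall a b, B a -> B b -> B (a * b)
    & forall a, B a -> B (star a)].

Definition vn_subalgebra B := star_subalgebra B /\
  forall a, wot_closure (act @` B) (act a) -> B a.

End Algebra.

(* [tau_normal]: tau preserves suprema of increasing nets of self-adjoint     *)
(* elements.                                                                  *)
Record tracialWStarSpace (R : realType) := TracialWStarSpace {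
  tw_alg :> vonNeumannAlgebra R ;
  tau : {scalar tw_alg} ;
  tau1 : tau 1 = 1 ;
  tau_pos : forall a : tw_alg, vn_pos a -> 0 <= tau a ;
  tau_faithful : forall a : tw_alg, tau (star a * a) = 0 -> a = 0 ;
  tau_tracial : forall a b : tw_alg, tau (a * b) = tau (b * a) ;
  tau_normal : forall (D : set tw_alg) (a : tw_alg),
    vn_directed D -> (forall d, D d -> self_adjoint d) -> vn_is_lub D a ->
    forall e : R, 0 < e -> exists2 d, D d & `|tau a - tau d| < e%:C }.

Section Free.
Context {R : realType} {A : tracialWStarSpace R}.
Implicit Types (a b : A) (B : set A) (U X Y Z : R -> A) (F : R -> set A).

Definition free_subalgebras (I : Type) (B : I -> set A) :=
  forall (n : nat) (i : nat -> I) (a : nat -> A), (0 < n)%N ->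
    (forall k, (k < n)%N -> B (i k) (a k) /\ tau A (a k) = 0) ->
    (forall k, (k.+1 < n)%N -> i k <> i k.+1) ->
    tau A (\prod_(0 <= k < n) a k) = 0.

Definition star_free B1 B2 :=
  free_subalgebras (fun i : bool =>
    smallest star_subalgebra (if i then B1 else B2)).

Definition spectral_distribution a (mu : probability (measurableTypeR R) R) :=
  self_adjoint a /\
  forall n : nat,
    mu.-integrable setT (fun x : R => (x ^+ n)%:E) /\
    tau A (a ^+ n) = (\int[mu]_x (x ^+ n))%:C.

(* Every self-adjoint element has exactly one spectral distribution. That     *)
(* fact is not built in, so the equality of moments is stated as well and the *)
(* last clause cannot hold merely for want of a measure mu.                   *)
Definition same_spectral_distribution a b :=
  [/\ self_adjoint a, self_adjoint b,
      forall n : nat, tau A (a ^+ n) = tau A (b ^+ n)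
    & forall mu, spectral_distribution a mu <-> spectral_distribution b mu].

Definition semicircle_density (v x : R) : R :=
  Num.sqrt (4 * v - x ^+ 2) / (2 * pi * v).

Definition semicircular (v : R) a := self_adjoint a /\
  forall n : nat, tau A (a ^+ n) =
    (\int[lebesgue_measure]_(x in `[- (2 * Num.sqrt v), 2 * Num.sqrt v])
        (x ^+ n * semicircle_density v x))%:C.

Definition filtration F :=
  (forall t, 0 <= t -> vn_subalgebra (F t)) /\
  (forall s t, 0 <= s -> s <= t -> F s `<=` F t).

Definition adapted F Y := forall t, 0 <= t -> F t (Y t).

Definition free_brownian_motion F X :=
  [/\ X 0 = 0,
      forall t, 0 <= t -> self_adjoint (X t),
      adapted F X
    & forall s t, 0 <= s -> s < t ->
        semicircular (t - s) (X t - X s) /\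
        star_free (F s) [set X t - X s]].

Definition norm2 a : R := Num.sqrt (complex.Re (tau A (star a * a))).

(* Along a partition 0 = t_0 < t_1 < ... < t_n = t, given as [t_1; ...; t_n]. *)
Definition ito_sum Z Y (s : seq R) : A :=
  \sum_(0 <= k < size s)
    (Z (nth 0 (0 :: s) k.+1) - Z (nth 0 (0 :: s) k)) * Y (nth 0 (0 :: s) k).

(* J is the Ito integral over [0, t] of dZ_s Y_s: the limit in L^2(tau) of    *)
(* the left-point sums as the mesh of the partition tends to 0.               *)
Definition ito_integral Z Y (t : R) (J : A) :=
  forall e : R, 0 < e -> exists2 d : R, 0 < d &
    forall s : seq R, itv_partition 0 t s ->
      (forall k, (k < size s)%N ->
         nth 0 (0 :: s) k.+1 - nth 0 (0 :: s) k < d) ->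
      norm2 (ito_sum Z Y s - J) < e.

Definition time_integral Y (t : R) (J : A) :=
  ito_integral (fun s => s%:C%:A) Y t J.

(* dU_t = i dX_t U_t - (1/2) U_t dt, in integrated form. *)
Definition solves_unitary_sde X U :=
  forall t, 0 <= t -> exists J1 J2 : A,
    [/\ ito_integral X U t J1, time_integral U t J2
      & U t = U 0 + 'i *: J1 - 2^-1 *: J2].

(* X is a free Brownian motion for some filtration to which U is adapted; the *)
(* filtration generated by X is a special case.                               *)
Definition free_unitary_brownian_motion U :=
  [/\ U 0 = 1,
      forall t, 0 <= t -> unitary (U t)
    & exists F X, [/\ filtration F, free_brownian_motion F X, adapted F U
                    & solves_unitary_sde X U]].

End Free.

(* Main.v *)
Require Import Defs.
From HB Require Import structures.
From mathcomp Require Import all_boot all_order all_algebra.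
From mathcomp Require Import sesquilinear complex.
From mathcomp Require Import all_classical all_reals all_analysis.
From mathcomp Require Import ring lra zify.

Import Order.TTheory GRing.Theory Num.Theory.
Import numFieldNormedType.Exports.

Local Open Scope classical_set_scope.
Local Open Scope complex_scope.
Local Open Scope ring_scope.

(** Put r = 2 P - 1, q = 2 Q - 1, V = r U_t q U_t^* and W = r q U_(2t). The square of
    the commutator is (2 - V^2 - V^-2) / 16 and the other element is
    (2 - W^2 - W^-2) / 16, so it suffices that V and W have the same moments
    ([commutator_sqr], [cos_product], [tau_sin_sqr]).

    This is proved by showing that v_n(t) = tau (V^n) and w_n(t) = tau ((r q U_t)^n)
    solve the same triangular system of differential equations
      z_n' = - k (n/2) (z_n + sum_(0 < p < n) z_p z_(n-p)),
    with k = 2 for v and k = 1 for w ([moments_conj_mul]). They agree at time 0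
    because U_0 = 1, and the system has only one solution
    ([moment_rate_unique]); since k only scales time, v_n(t) = w_n(2 t).

    The system is obtained in two stages. First, the stochastic equation gives it
    for the powers of U_t alone, with k = 1 ([rate_power]): the increment of U over
    a time d^2 is i dX U - (1/2) d^2 U up to terms that do not matter, terms linear
    in dX have trace 0, quadratic ones are evaluated by freeness of dX from the
    past, and cubic ones are of order d^3.

    Second, the process U is free from P and Q, but nothing is known about X and
    the pair P, Q, so the stochastic equation cannot be used on words that mix U_t
    with P and Q. However freeness expresses the trace of such a word as a fixed
    polynomial in the moments of U_t, and its derivative is therefore determined by
    the first stage. To identify this derivative, perturb u into exp(i d x) u for a
    fictitious semicircular x free from everything and collect the terms of order
    d^2; the result is the drift of the word, defined here by a recursion on the
    letters. The drift of a word is the rate of change of its trace ([block_rate]):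
    both sides reduce, by centering words in u and constants alternately and by
    induction on the number of blocks, to alternating centered words, and for these
    the trace and the drift vanish by freeness ([tau_value_centered],
    [tau_drift_centered]). The drifts of the words (r u q u^* )^n and (r q u)^n are
    then computed explicitly ([drift_iter_conj], [drift_iter_u]). *)

(** * The modulus with values in the reals *)

Section Modulus.
Context {R : realType}.
Implicit Types z : R[i].

(** The order of [R[i]] is only partial; estimates are carried out in [R]. *)
Definition cabs z : R := complex.Re `|z|.

Lemma cabsE z : `|z| = (cabs z)%:C.
Proof. by rewrite /cabs RRe_real // normr_real. Qed.

Lemma cabs_ge0 z : 0 <= cabs z.
Proof. by rewrite -ler0c -cabsE. Qed.

Lemma cabsM z w : cabs (z * w) = cabs z * cabs w.
Proof. by apply: complexI; rewrite rmorphM /= -!cabsE normrM. Qed.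

Lemma cabsD z w : cabs (z + w) <= cabs z + cabs w.
Proof. by rewrite -lecR rmorphD /= -!cabsE ler_normD. Qed.

Lemma cabsN z : cabs (- z) = cabs z.
Proof. by rewrite /cabs normrN. Qed.

Lemma cabsB z w : cabs (z - w) <= cabs z + cabs w.
Proof. by rewrite -(cabsN w) cabsD. Qed.

Lemma cabs0 : cabs 0 = 0 :> R.
Proof. by rewrite /cabs normr0. Qed.

Lemma cabs_eq0 z : cabs z = 0 -> z = 0.
Proof. by move=> z0; apply/eqP; rewrite -normr_eq0 cabsE z0. Qed.

Lemma cabsJ z : cabs z^* = cabs z.
Proof. by rewrite /cabs norm_conjC. Qed.

Lemma cabs_real (x : R) : cabs x%:C = `|x|.
Proof.
by apply: complexI; rewrite -cabsE normc_def /= expr0n addr0 sqrtr_sqr.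
Qed.

Lemma cabs_i : cabs 'i = 1.
Proof. by apply: complexI; rewrite -cabsE normCi. Qed.

Lemma cabs_sqr z : ((cabs z) ^+ 2)%:C = z * z^*.
Proof. by rewrite rmorphXn /= -cabsE normCK. Qed.

Lemma cabs_half : cabs 2^-1 = 2^-1 :> R.
Proof.
by rewrite -(rmorph_nat (real_complex R)) -fmorphV /= cabs_real ger0_norm // invr_ge0.
Qed.

Lemma cabs_sum (I : Type) (s : seq I) (F : I -> R[i]) :
  cabs (\sum_(i <- s) F i) <= \sum_(i <- s) cabs (F i).
Proof.
elim/big_rec2: _ => [|i y z _ le_yz]; first by rewrite cabs0.
by apply: le_trans (cabsD _ _) _; rewrite lerD2l.
Qed.

End Modulus.

(** * Adjoint, trace and the norm of L2(tau) *)

Section StarAlgebra.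
Context {R : realType} {A : vonNeumannAlgebra R}.
Implicit Types a b u v : A.
Local Notation H := (vn_space A).

Lemma inner_inj (x y : H) : (forall z, inner H z x = inner H z y) -> x = y.
Proof.
move=> eq_xy; apply/eqP; rewrite -subr_eq0 -normr_eq0 -sqrf_eq0 -inner_norm.
by rewrite linearBr /= eq_xy subrr.
Qed.

Lemma inner_conj (x y : H) : inner H x y = (inner H y x)^*.
Proof. by rewrite hermC /= mul1r. Qed.

Lemma act_eq a b : (forall x y, inner H x (act a y) = inner H x (act b y)) ->
  a = b.
Proof. by move=> eq_ab; apply: act_inj => x; apply: inner_inj. Qed.

Lemma act_star' a x y : inner H x (act a y) = inner H (act (star a) x) y.
Proof. by rewrite inner_conj act_star -inner_conj. Qed.

Lemma starK : involutive (@star R A).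
Proof. by move=> a; apply: act_eq => x y; rewrite -act_star -act_star'. Qed.

Lemma star1 : star 1 = 1 :> A.
Proof. by apply: act_eq => x y; rewrite -act_star !act1. Qed.

Lemma starD a b : star (a + b) = star a + star b.
Proof.
by apply: act_eq => x y; rewrite -act_star !actD linearDl linearDr /= !act_star.
Qed.

Lemma starZ (c : R[i]) a : star (c *: a) = c^* *: star a.
Proof.
apply: act_eq => x y; rewrite -act_star !actZ linearZl_LR /= act_star.
by rewrite linearZr_LR /= conjCK.
Qed.

Lemma starM a b : star (a * b) = star b * star a.
Proof. by apply: act_eq => x y; rewrite -act_star !actM !act_star. Qed.

Lemma starN a : star (- a) = - star a.
Proof. by rewrite -scaleN1r starZ rmorphN rmorph1 !scaleN1r. Qed.

Lemma starB a b : star (a - b) = star a - star b.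
Proof. by rewrite starD starN. Qed.

Lemma star0 : star 0 = 0 :> A.
Proof. by rewrite -(subrr 1) starB !subrr. Qed.

Lemma starX a n : star (a ^+ n) = star a ^+ n.
Proof.
by elim: n => [|n IHn]; rewrite ?star1 // exprS starM IHn -exprSr.
Qed.

Lemma star_nat n : star n%:R = n%:R :> A.
Proof. by elim: n => [|n IHn]; rewrite ?star0 // -addn1 natrD starD IHn star1. Qed.

Lemma vn_pos_star a : vn_pos (star a * a).
Proof. by move=> x; rewrite actM act_star starK dnorm_ge0. Qed.

Lemma unitary1 : unitary (1 : A).
Proof. by split; rewrite star1 mulr1. Qed.

Lemma unitaryM u v : unitary u -> unitary v -> unitary (u * v).
Proof.
move=> [u1 u2] [v1 v2]; split; rewrite starM.
  by rewrite mulrA -(mulrA (star v)) u1 mulr1.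
by rewrite mulrA -(mulrA u) v2 mulr1.
Qed.

Lemma unitary_star u : unitary u -> unitary (star u).
Proof. by case=> u1 u2; split; rewrite starK. Qed.

Lemma unitaryX u n : unitary u -> unitary (u ^+ n).
Proof.
move=> uu; elim: n => [|n IHn]; first exact: unitary1.
by rewrite exprS; exact: unitaryM.
Qed.

End StarAlgebra.

Section StarSubalgebra.
Context {R : realType} {A : vonNeumannAlgebra R} (B : set A).
Hypothesis sB : star_subalgebra B.

Lemma ssub1 : B 1. Proof. by case: sB. Qed.
Lemma ssubD a b : B a -> B b -> B (a + b). Proof. by case: sB => _ + _ _ _; exact. Qed.
Lemma ssubZ c a : B a -> B (c *: a). Proof. by case: sB => _ _ + _ _; exact. Qed.
Lemma ssubM a b : B a -> B b -> B (a * b). Proof. by case: sB => _ _ _ + _; exact. Qed.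
Lemma ssub_star a : B a -> B (star a). Proof. by case: sB => _ _ _ _; exact. Qed.
Lemma ssubN a : B a -> B (- a).
Proof. by rewrite -scaleN1r; exact: ssubZ. Qed.
Lemma ssubB a b : B a -> B b -> B (a - b).
Proof. by move=> Ba /ssubN; exact: ssubD. Qed.
Lemma ssubC c : B c%:A. Proof. exact: ssubZ ssub1. Qed.
Lemma ssub0 : B 0. Proof. by rewrite -(scale0r 1); exact: ssubC. Qed.
Lemma ssubX a n : B a -> B (a ^+ n).
Proof.
move=> Ba; elim: n => [|n IHn]; first exact: ssub1.
by rewrite exprS; exact: ssubM.
Qed.
End StarSubalgebra.

Lemma smallest_star_subalgebra {R : realType} {A : vonNeumannAlgebra R}
  (G : set A) : star_subalgebra (smallest star_subalgebra G).
Proof.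
split.
- by move=> B [sB _]; exact: ssub1.
- by move=> a b Ga Gb B sB; apply: (ssubD _ sB.1); [exact: Ga|exact: Gb].
- by move=> c a Ga B sB; apply: (ssubZ _ sB.1); exact: Ga.
- by move=> a b Ga Gb B sB; apply: (ssubM _ sB.1); [exact: Ga|exact: Gb].
- by move=> a Ga B sB; apply: (ssub_star _ sB.1); exact: Ga.
Qed.

Section Trace.
Context {R : realType} {A : tracialWStarSpace R}.
Implicit Types a b c u v x y : A.

Lemma tauC (c : R[i]) : tau A c%:A = c.
Proof. by rewrite linearZ /= tau1 mulr1. Qed.

Lemma tauZ (c : R[i]) a : tau A (c *: a) = c * tau A a.
Proof. exact: linearZ. Qed.

(** Positivity of tau on (1 + b)^* (1 + b) makes tau b + tau b^* real; the cases
    b = a and b = i a together determine tau a^*. *)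
Lemma tau_star a : tau A (star a) = (tau A a)^*.
Proof.
have re b : (tau A b + tau A (star b))^* = tau A b + tau A (star b).
  have := tau_pos (vn_pos_star (1 + b)); have := tau_pos (vn_pos_star b).
  rewrite starD star1 mulrDl mul1r mulrDr mulr1 !linearD /= tau1.
  move=> /ger0_real pb /ger0_real; rewrite !realE.
  move: pb; rewrite -!realE => pb pb1.
  apply: CrealP.
  have -> : tau A b + tau A (star b) = 1 + tau A b +
     (tau A (star b) + tau A (star b * b)) - 1 - tau A (star b * b) by ring.
  by rewrite !rpredB // rpred1.
have := re ('i *: a); rewrite starZ conjCi !linearZ /= => eq2; have := re a.
rewrite !rmorphD /= !rmorphM /= rmorphN /= conjCi in eq2 *.
set p := tau A a in eq2 *; set q := tau A (star a) in eq2 * => eq1.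
have {}eq2 : p^* - q^* = q - p.
  apply: (mulfI (neq0Ci R[i])); apply/eqP; rewrite -subr_eq0.
  move/eqP: eq2; rewrite -subr_eq0 => /eqP eq2.
  by rewrite -oppr_eq0; apply/eqP; rewrite -[RHS]eq2; ring.
apply: (mulfI (_ : 2%:R != 0 :> R[i])); first by rewrite pnatr_eq0.
transitivity ((p + q) + (q - p)); first by ring.
by rewrite -eq1 -eq2; ring.
Qed.

Lemma norm2_ge0 a : 0 <= norm2 a.
Proof. exact: sqrtr_ge0. Qed.

Lemma norm2_sqr a : ((norm2 a) ^+ 2)%:C = tau A (star a * a).
Proof.
have p := tau_pos (vn_pos_star a).
rewrite /norm2 sqr_sqrtr; first by rewrite RRe_real // ger0_real.
by move: p; rewrite lecE => /andP[].
Qed.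

Lemma norm2_eq a b : tau A (star a * a) = tau A (star b * b) ->
  norm2 a = norm2 b.
Proof. by rewrite /norm2 => ->. Qed.

Lemma norm2_star a : norm2 (star a) = norm2 a.
Proof. by apply: norm2_eq; rewrite starK tau_tracial. Qed.

Lemma norm2_unitaryl u a : unitary u -> norm2 (u * a) = norm2 a.
Proof.
by case=> u1 _; apply: norm2_eq; rewrite starM mulrA -(mulrA (star a)) u1 mulr1.
Qed.

Lemma norm2_unitaryr u a : unitary u -> norm2 (a * u) = norm2 a.
Proof.
by move=> uu; rewrite -norm2_star starM norm2_unitaryl ?norm2_star //; exact: unitary_star.
Qed.

Lemma norm2Z (c : R[i]) a : norm2 (c *: a) = cabs c * norm2 a.
Proof.
apply/eqP; rewrite -(@eqrXn2 _ 2) // ?mulr_ge0 ?norm2_ge0 ?cabs_ge0 //; apply/eqP.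
apply: complexI; rewrite norm2_sqr exprMn rmorphM /= cabs_sqr norm2_sqr.
by rewrite starZ -scalerAl -scalerAr !linearZ /=; ring.
Qed.

Lemma norm2_eq0 a : norm2 a = 0 -> a = 0.
Proof. by move=> a0; apply: tau_faithful; rewrite -norm2_sqr a0 expr0n. Qed.

Lemma norm2_0 : norm2 (0 : A) = 0.
Proof. by rewrite -(scale0r 0) norm2Z cabs0 mul0r. Qed.

Lemma norm2_1 : norm2 (1 : A) = 1.
Proof.
apply/eqP; rewrite -(@eqrXn2 _ 2) ?norm2_ge0 ?ler01 //; apply/eqP.
by apply: complexI; rewrite norm2_sqr star1 mulr1 tau1 expr1n.
Qed.

Lemma norm2_unitary u : unitary u -> norm2 u = 1.
Proof. by move=> uu; rewrite -(mulr1 u) norm2_unitaryl ?norm2_1. Qed.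

Lemma norm2N a : norm2 (- a) = norm2 a.
Proof. by apply: norm2_eq; rewrite starN mulrNN. Qed.

(** Cauchy-Schwarz for the inner product (a, b) |-> tau (b^* a); the trace makes
    the norm invariant under the adjoint, so no adjoint appears here. *)
Lemma tau_CauchySchwarz a b : cabs (tau A (a * b)) <= norm2 a * norm2 b.
Proof.
have [b0|nb0] := eqVneq (norm2 b) 0.
  by rewrite b0 (norm2_eq0 _ b0) mulr0 linear0 cabs0 mulr0.
have b_gt0 : 0 < norm2 b by rewrite lt_def nb0 norm2_ge0.
rewrite -(@ler_pXn2r _ 2) ?nnegrE ?mulr_ge0 ?norm2_ge0 ?cabs_ge0 //.
(* a^* minus its orthogonal projection on b has nonnegative norm. *)
pose z := tau A (a * b); set n : R[i] := ((norm2 b) ^+ 2)%:C.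
have n0 : n != 0 by rewrite fmorph_eq0 sqrf_eq0.
have nJ : n^* = n by exact: conjc_real.
have := tau_pos (vn_pos_star (star a - (z^* / n) *: b)).
rewrite starB starK starZ mulrBl !mulrBr -!scalerAl -!scalerAr !linearB /= !tauZ.
have -> : tau A (star b * star a) = z^* by rewrite -starM tau_star.
rewrite -norm2_sqr (tau_tracial a (star a)) -norm2_sqr -/z -/n.
rewrite (rmorphM _ z^*) fmorphV /= nJ conjCK.
have E (x y y' m : R[i]) : m != 0 -> x - y' / m * y +
    (- (y / m * y') - - (y / m * (y' / m * m))) = x - (y * y') / m.
  by move=> m0; field.
rewrite E //.
rewrite subr_ge0 ler_pdivrMr; last by rewrite ltcR exprn_gt0.
by rewrite -cabs_sqr -rmorphM /= lecR exprMn.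
Qed.

Lemma norm2D a b : norm2 (a + b) <= norm2 a + norm2 b.
Proof.
rewrite -(@ler_pXn2r _ 2) ?nnegrE ?addr_ge0 ?norm2_ge0 //.
rewrite -lecR norm2_sqr starD mulrDl !mulrDr !linearD /= -!norm2_sqr.
have -> : tau A (star b * a) = (tau A (star a * b))^*.
  by rewrite -tau_star starM starK.
set z := tau A _; rewrite sqrrD !rmorphD /=.
have E (x y p q : R[i]) : x + p + (q + y) = x + (p + q) + y by ring.
rewrite E lerD2r lerD2l addcJ -(rmorph_nat (real_complex R)) -rmorphM /=.
rewrite -(rmorphD (real_complex R)) /= lecR.
suff le_z : complex.Re z <= norm2 a * norm2 b by lra.
apply: (@le_trans _ _ (cabs z)); last by rewrite (le_trans (tau_CauchySchwarz _ _)) // norm2_star.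
by rewrite -lecR -cabsE; apply: le_trans (normc_ge_Re _); rewrite lecR ler_norm.
Qed.

Lemma norm2B a b : norm2 (a - b) <= norm2 a + norm2 b.
Proof. by rewrite -(norm2N b); exact: norm2D. Qed.

Lemma cabs_tau_le a : cabs (tau A a) <= norm2 a.
Proof. by rewrite -(mul1r a) (le_trans (tau_CauchySchwarz _ _)) // norm2_1 !mul1r. Qed.

Lemma cabs_tau_unitary u : unitary u -> cabs (tau A u) <= 1.
Proof. by move=> uu; rewrite -(norm2_unitary _ uu) cabs_tau_le. Qed.

Lemma norm2_sqrt (a : A) (x : R) : tau A (star a * a) = x%:C ->
  norm2 a = Num.sqrt x.
Proof. by rewrite /norm2 => ->. Qed.

Lemma norm2_le_sqr (a : A) (x : R) : 0 <= x -> norm2 a ^+ 2 <= x ^+ 2 -> norm2 a <= x.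
Proof. by move=> x0; rewrite ler_pXn2r ?nnegrE ?norm2_ge0. Qed.

(** First-order substitution D = e + Y in the two leftmost occurrences of D, one
    after the other. *)
Lemma tau_expand (D e Y a c : A) : D = e + Y ->
  tau A (D * a * D * c) =
  tau A (e * (a * D * c)) + tau A (Y * a * e * c) + tau A (Y * a * Y * c).
Proof.
move=> DE; rewrite -addrA {1}DE !mulrDl linearD /= !mulrA; congr (_ + _).
by rewrite DE mulrDr mulrDl linearD.
Qed.

End Trace.

Lemma mem_smallest_star {R : realType} {A : vonNeumannAlgebra R} (G : set A) a :
  G a -> smallest star_subalgebra G a.
Proof. by move=> Ga B [_]; exact. Qed.

(** * Moments of the semicircle law *)

Section Semicircle.
Context {R : realType}.
Local Notation mu := (@lebesgue_measure R).

Section Moments.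
Variables (v : R) (v_gt0 : 0 < v).
Let r : R := 2 * Num.sqrt v.
Let c : R := 4 * v.

Let r_gt0 : 0 < r. Proof. by rewrite mulr_gt0 // sqrtr_gt0. Qed.
Let r_sqr : r ^+ 2 = c.
Proof. by rewrite exprMn sqr_sqrtr ?ltW // /c; ring. Qed.

Definition semicircle_moment n : R :=
  \int[mu]_(x in `[- r, r]) (x ^+ n * semicircle_density v x).

Let density_continuous : continuous (semicircle_density v).
Proof.
move=> x; apply: cvgM; last exact: cvg_cst.
apply: continuous_comp; last exact: sqrt_continuous.
by apply: cvgB; [exact: cvg_cst|exact: exprn_continuous].
Qed.

Let pow_density_continuous n : continuous (fun x : R => x ^+ n * semicircle_density v x).
Proof.
by move=> x; apply: cvgM; [exact: exprn_continuous|exact: density_continuous].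
Qed.

Let pow_density_integrable n : mu.-integrable `[- r, r]
  (EFin \o (fun x : R => x ^+ n * semicircle_density v x)).
Proof.
apply: continuous_compact_integrable; first exact: segment_compact.
exact/continuous_subspaceT/pow_density_continuous.
Qed.

(* F k is x^k (c - x^2)^(3/2) up to a constant: it vanishes at both ends of the
   support, and f k is its derivative. *)
Let F k (x : R) : R := x ^+ k * ((c - x ^+ 2) * semicircle_density v x).
Let f k (x : R) : R := k%:R * c * (x ^+ k.-1 * semicircle_density v x) -
    (k + 3)%:R * (x ^+ k.+1 * semicircle_density v x).

Let F_derive k x : - r < x < r -> is_derive x 1 (F k) (f k x).
Proof.
move=> /andP[rx xr].
have pos : 0 < c - x ^+ 2.
  by rewrite -r_sqr subr_sqr mulr_gt0; lra.
have pos' := pos; rewrite -sqrtr_gt0 in pos'.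
have dq : is_derive x 1 (cst c - @GRing.exp R ^~ 2) (- (2 * x)).
  have -> : @GRing.exp R ^~ 2 = id ^+ 2 by apply/funext => y; rewrite fctE.
  have := is_deriveB (is_derive_cst c x 1) (@is_deriveX R R id 2 x 1 1 (is_derive_id x 1)).
  by rewrite /GRing.scale /= mulr1 sub0r expr1.
have ds : is_derive x 1 (Num.sqrt \o (cst c - @GRing.exp R ^~ 2))
    (- x / Num.sqrt (c - x ^+ 2)).
  have dc := @is_derive1_comp R Num.sqrt (cst c - @GRing.exp R ^~ 2) x _ _
    (is_derive1_sqrt pos) dq.
  apply: (is_derive_eq dc); by field; rewrite gt_eqF.
have dX : is_derive x 1 (id ^+ k : R -> R) (k%:R * x ^+ k.-1).
  have := @is_deriveX R R id k x 1 1 (is_derive_id x 1).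
  by rewrite /GRing.scale /= mulr1.
have -> : F k = (2 * pi * v)^-1 \*:
    ((id ^+ k) * ((cst c - @GRing.exp R ^~ 2) *
       (Num.sqrt \o (cst c - @GRing.exp R ^~ 2)))).
  apply/funext => y; rewrite /F /semicircle_density -/c !fctE.
  by rewrite [RHS]mulrC !mulrA.
apply: is_derive_eq; rewrite /f /semicircle_density -/c /= !fctE /=.
have pv : 2 * pi * v != 0 by rewrite !mulf_neq0 // gt_eqF // pi_gt0.
set q := (2 * pi * v)^-1; set w := Num.sqrt _.
have wE : c - x ^+ 2 = w ^+ 2 by rewrite sqr_sqrtr // ltW.
have w0 : w != 0 by rewrite gt_eqF.
have xk : k%:R * x ^+ k.+1 = k%:R * x ^+ k.-1 * x ^+ 2 :> R.
  by case: (k) => [|m]; rewrite ?mul0r //= -mulrA -exprD addn2.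
have cE : c = w ^+ 2 + x ^+ 2 by rewrite -wE subrK.
rewrite /GRing.scale /= wE [in RHS]cE natrD [in RHS]mulrDl ![in RHS]mulrA xk (exprS x k).
move: (x ^+ k) (x ^+ k.-1) (k%:R) => p y n; clearbody q w.
by field.
Qed.

(** The derivative of x^k (c - x^2)^(3/2) has integral 0 over the support. *)
Lemma semicircle_moment_rec k :
  k%:R * c * semicircle_moment k.-1 = (k + 3)%:R * semicircle_moment k.+1.
Proof.
have cF : continuous (F k).
  move=> x; apply: cvgM; first exact: exprn_continuous.
  apply: cvgM; last exact: density_continuous.
  by apply: cvgB; [exact: cvg_cst|exact: exprn_continuous].
have ff : f k = (fun x : R => k%:R * c * (x ^+ k.-1 * semicircle_density v x)) \-
    (fun x : R => (k + 3)%:R * (x ^+ k.+1 * semicircle_density v x)) by [].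
have F0 x : x ^+ 2 = c -> F k x = 0 by rewrite /F => ->; rewrite subrr mul0r mulr0.
have : \int[mu]_(x in `[- r, r]) f k x = 0.
  rewrite /Rintegral (continuous_FTC2 (F := F k)); first 1 last.
  - by rewrite gtrN.
  - apply: continuous_subspaceT => x; rewrite ff.
    by apply: cvgB; (apply: cvgM; first exact: cvg_cst); exact: pow_density_continuous.
  - split.
    + by move=> x; rewrite in_itv /= => /(F_derive k) [].
    + exact/cvg_at_right_filter/cF.
    + exact/cvg_at_left_filter/cF.
  - by move=> x; rewrite in_itv /= => /(F_derive k) xx; rewrite derive1E derive_val.
  by rewrite !F0 ?sqrrN ?r_sqr // subee.
rewrite ff RintegralB //; last 2 first.
- exact: (@integrableZl _ _ _ _ _ _ (k%:R * c) _ (pow_density_integrable _)).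
- exact: (@integrableZl _ _ _ _ _ _ (k + 3)%:R _ (pow_density_integrable _)).
by rewrite !RintegralZl // => /eqP; rewrite subr_eq0 => /eqP.
Qed.

End Moments.

Context {A : tracialWStarSpace R}.

(** The recurrence yields the moments from the mass of the law, and the mass is 1
    because it is tau 1. *)
Lemma semicircular_moments (v : R) (a : A) : 0 < v -> semicircular v a ->
  [/\ tau A a = 0, tau A (a ^+ 2) = v%:C & tau A (a ^+ 4) = (2 * v ^+ 2)%:C].
Proof.
move=> v0 [_ mom]; have rec := semicircle_moment_rec v v0.
have M0 : semicircle_moment v 0 = 1.
  by apply: complexI; rewrite -mom expr0 tau1.
have M1 : semicircle_moment v 1 = 0 by have := rec 0%N => /=; lra.
have M2 : semicircle_moment v 2 = v by have := rec 1%N => /=; rewrite M0; lra.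
have M4 : semicircle_moment v 4 = 2 * v ^+ 2.
  by have := rec 3%N => /=; rewrite M2; lra.
have m n : tau A (a ^+ n) = (semicircle_moment v n)%:C by exact: mom.
by split; [rewrite -[a]expr1 m M1 | rewrite m M2 | rewrite m M4].
Qed.
End Semicircle.

(** * Mixed moments of free elements *)

Lemma star_free_sym {R : realType} {A : tracialWStarSpace R} (B1 B2 : set A) :
  star_free B1 B2 -> star_free B2 B1.
Proof.
move=> fr n i a n0 cent alt; apply: (fr n (fun k => ~~ i k) a n0).
  by move=> k kn; have := cent k kn; case: (i k).
by move=> k kn; have := alt k kn; case: (i k); case: (i k.+1).
Qed.

Section Freeness.
Context {R : realType} {A : tracialWStarSpace R}.
Variables (B1 B2 : set A).
Hypothesis free12 : star_free B1 B2.
Local Notation SA := (smallest star_subalgebra B1).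
Local Notation SB := (smallest star_subalgebra B2).
Local Notation S i := (smallest star_subalgebra (if i then B1 else B2)).

Definition centered_in (B : set A) (a : A) := B a /\ tau A a = 0.

Lemma centered_sub (B : set A) a : star_subalgebra B -> B a ->
  centered_in B (a - (tau A a)%:A).
Proof.
move=> sB Ba; split; first by apply: ssubB => //; exact: ssubC.
by rewrite linearB /= tauC subrr.
Qed.

Lemma free_seq (s : seq (bool * A)) : s != [::] ->
  (forall x, x \in s -> centered_in (S x.1) x.2) ->
  sorted (fun x y => x.1 != y.1) s ->
  tau A (\prod_(x <- s) x.2) = 0.
Proof.
move=> s0 cs alt; rewrite (big_nth (true, 0)).
apply: (free12 (size s) (fun k => (nth (true, 0) s k).1)
  (fun k => (nth (true, 0) s k).2)).
- by rewrite lt0n size_eq0.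
- by move=> k ks; apply: cs; rewrite mem_nth.
- move=> k ks; apply/eqP.
  exact: (sortedP (true, 0) alt).
Qed.

Lemma free_pair a b : SA a -> SB b -> tau A (a * b) = tau A a * tau A b.
Proof.
move=> sa sb.
have ca := centered_sub _ _ (smallest_star_subalgebra B1) sa.
have cb := centered_sub _ _ (smallest_star_subalgebra B2) sb.
have := free_seq [:: (true, a - (tau A a)%:A); (false, b - (tau A b)%:A)].
rewrite !big_cons big_nil mulr1 => H.
have {H} : tau A ((a - (tau A a)%:A) * (b - (tau A b)%:A)) = 0.
  by apply: H => // x; rewrite !inE => /orP[] /eqP ->.
rewrite mulrBl !mulrBr -!scalerAl -!scalerAr !mul1r !mulr1 !linearB /= !tauZ tau1.
rewrite mulr1 => H; apply/eqP; rewrite -subr_eq0; apply/eqP.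
by rewrite -[RHS]H; ring.
Qed.

(** Write b and c as centered element plus scalar: only the product of the two
    scalars survives. *)
Lemma free_quad x b c : centered_in SA x -> SB b -> SB c ->
  tau A (x * b * x * c) = tau A (x * x) * tau A b * tau A c.
Proof.
move=> [sx x0] sb sc.
have sA := smallest_star_subalgebra B1; have sB := smallest_star_subalgebra B2.
have [sb0 b0] := centered_sub _ _ sB sb.
have [sc0 c0] := centered_sub _ _ sB sc.
set b' := b - _ in sb0 b0; set c' := c - _ in sc0 c0.
have bE : b = b' + (tau A b)%:A by rewrite subrK.
have cE : c = c' + (tau A c)%:A by rewrite subrK.
set r := RHS; rewrite bE cE; clearbody b' c'.
rewrite !(mulrDr, mulrDl) -!(scalerAl, scalerAr) !mulr1 !linearD /= !tauZ.
have -> : tau A (x * b' * x * c') = 0.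
  have := free_seq [:: (true, x); (false, b'); (true, x); (false, c')].
  rewrite !big_cons big_nil mulr1 !mulrA; apply => //.
  by move=> y; rewrite !inE => /or4P[] /eqP ->.
have -> : tau A (x * x * c') = 0.
  by rewrite free_pair ?c0 ?mulr0 //; exact: (ssubM _ sA).
have -> : tau A (x * b' * x) = 0.
  by rewrite tau_tracial mulrA free_pair ?b0 ?mulr0 //; exact: (ssubM _ sA).
by rewrite !mulr0 !add0r /r; ring.
Qed.

End Freeness.

(** * Partitions and left-point sums *)

Section Partitions.
Context {R : realType} {A : tracialWStarSpace R}.
Implicit Types (Z Y : R -> A) (a b d : R) (p : seq R).

Definition fine d (x y : R) := (x < y) && (y - x < d).

Lemma fine_lt d a p : path (fine d) a p -> path <%R a p.
Proof. by apply: sub_path => x y /andP[]. Qed.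

Lemma fineS d d' a p : d <= d' -> path (fine d) a p -> path (fine d') a p.
Proof.
by move=> dd; apply: sub_path => x y /andP[xy h]; rewrite /fine xy (lt_le_trans h).
Qed.

Lemma path_le_last a p : path <%R a p -> a <= last a p.
Proof.
elim: p a => //= x p IHp a /andP[ax xp].
exact: le_trans (ltW ax) (IHp _ xp).
Qed.

Lemma fine_partition d a b : 0 < d -> a <= b ->
  exists2 p, path (fine d) a p & last a p = b.
Proof.
move=> d0 ab.
have [N] : exists N, b - a <= N%:R * (d / 2).
  exists (Num.Def.archi_bound ((b - a) / (d / 2))).
  rewrite -ler_pdivrMr ?divr_gt0 // ltW // archi_boundP //.
  by rewrite divr_ge0 ?subr_ge0 // divr_ge0 // ltW.
elim: N a ab => [|N IHN] a ab.
  rewrite mul0r subr_le0 => ba; exists [::] => //=.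
  by apply/eqP; rewrite eq_le ab ba.
move=> bN; have [bd|bd] := leP (b - a) (d / 2).
  have [->|neq_ab] := eqVneq a b; first by exists [::].
  exists [:: b] => //=; rewrite andbT /fine lt_def ab eq_sym neq_ab /=; lra.
have [||p pp lp] := IHN (a + d / 2); first by lra.
  by move: bN; rewrite -natr1 mulrDl mul1r; lra.
exists (a + d / 2 :: p) => //=; rewrite pp /fine andbT.
by apply/andP; split; lra.
Qed.

(** [ito_sum] for a partition starting at an arbitrary point a. *)
Fixpoint left_sum Z Y a p : A :=
  if p is x :: p' then (Z x - Z a) * Y a + left_sum Z Y x p' else 0.

Lemma ito_sumE Z Y p : ito_sum Z Y p = left_sum Z Y 0 p.
Proof.
have gen x0 a : \sum_(0 <= k < size p)
    (Z (nth x0 (a :: p) k.+1) - Z (nth x0 (a :: p) k)) * Y (nth x0 (a :: p) k) =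
    left_sum Z Y a p; last exact: gen.
elim: p a => [|x p IHp] a; first by rewrite big_geq.
by rewrite big_nat_recl //= -IHp.
Qed.

Lemma left_sum_cat Z Y a p q :
  left_sum Z Y a (p ++ q) = left_sum Z Y a p + left_sum Z Y (last a p) q.
Proof. by elim: p a => [|x p IHp] a /=; rewrite ?add0r // IHp addrA. Qed.

Lemma left_sum_subr Z Y c a p :
  left_sum Z (fun r => Y r - c) a p =
  left_sum Z Y a p - (Z (last a p) - Z a) * c.
Proof.
elim: p a => [|x p IHp] a /=; first by rewrite subrr mul0r subr0.
have -> : Z (last x p) - Z a = (Z (last x p) - Z x) + (Z x - Z a).
  by rewrite addrA subrK.
by rewrite IHp mulrBr (mulrDl (Z (last x p) - Z x)) opprD (AC (2*2) ((1*3)*(4*2))).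
Qed.

Lemma ito_integral_fine Z Y t J e : ito_integral Z Y t J -> 0 < e ->
  exists2 d, 0 < d & forall p, path (fine d) 0 p -> last 0 p = t ->
    norm2 (left_sum Z Y 0 p - J) < e.
Proof.
move=> ZJ /ZJ[d d0 H]; exists d => // p pp lp; rewrite -ito_sumE; apply: H.
  by split; [exact: fine_lt pp|exact/eqP].
by move=> k ks; have /andP[] := (pathP 0 pp) k ks.
Qed.

End Partitions.

(** * One step of the stochastic differential equation *)

Section Ito.
Context {R : realType} {A : tracialWStarSpace R}.
Variables (F : R -> set A) (X U : R -> A).
Hypothesis filtF : filtration F.
Hypothesis bmX : free_brownian_motion F X.
Hypothesis adU : adapted F U.
Hypothesis sdeU : solves_unitary_sde X U.
Hypothesis unitU : forall t, 0 <= t -> unitary (U t).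
Local Notation clock := (fun r : R => r%:C%:A : A).

Let F_sub t : 0 <= t -> star_subalgebra (F t).
Proof. by case: filtF => + _ t0 => /(_ _ t0) []. Qed.

Let F_mono s t a : 0 <= s -> s <= t -> F s a -> F t a.
Proof. by move=> s0 st; case: filtF => _ /(_ s t s0 st); apply. Qed.

Let F_X t : 0 <= t -> F t (X t). Proof. by case: bmX => _ _ + _; apply. Qed.

Lemma increment_moments s t : 0 <= s -> s < t ->
  [/\ tau A (X t - X s) = 0, tau A ((X t - X s) ^+ 2) = (t - s)%:C
    & tau A ((X t - X s) ^+ 4) = (2 * (t - s) ^+ 2)%:C].
Proof.
move=> s0 st; case: bmX => _ _ _ /(_ s t s0 st) [sc _].
by apply: semicircular_moments sc; rewrite subr_gt0.
Qed.

Lemma increment_sa s t : 0 <= s -> 0 <= t -> star (X t - X s) = X t - X s.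
Proof.
by case: bmX => _ sa _ _ s0 t0; rewrite starB [star (X t)]sa // [star (X s)]sa.
Qed.

Lemma increment_free s t : 0 <= s -> s < t -> star_free (F s) [set X t - X s].
Proof. by case: bmX => _ _ _ H s0 st; have [] := H s t s0 st. Qed.

Lemma increment_pair s t c : 0 <= s -> s < t -> F s c ->
  tau A (c * (X t - X s)) = 0.
Proof.
move=> s0 st Fc; rewrite (free_pair _ _ (increment_free _ _ s0 st)).
- by have [-> _ _] := increment_moments s t s0 st; rewrite mulr0.
- exact: mem_smallest_star.
- exact: mem_smallest_star.
Qed.

Lemma increment_sqr_pair s t c : 0 <= s -> s < t -> F s c ->
  tau A (c * (X t - X s) ^+ 2) = (t - s)%:C * tau A c.
Proof.
move=> s0 st Fc; rewrite (free_pair _ _ (increment_free _ _ s0 st)).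
- by have [_ -> _] := increment_moments s t s0 st; rewrite mulrC.
- exact: mem_smallest_star.
- apply: (ssubX _ (smallest_star_subalgebra _)).
  exact: mem_smallest_star.
Qed.

Lemma increment_quad s t b c : 0 <= s -> s < t -> F s b -> F s c ->
  tau A ((X t - X s) * b * (X t - X s) * c) = (t - s)%:C * tau A b * tau A c.
Proof.
move=> s0 st Fb Fc; have := increment_free _ _ s0 st => /star_free_sym fr.
have [m1 m2 _] := increment_moments s t s0 st.
rewrite (free_quad _ _ fr) -?expr2 ?m2 //.
- by split => //; exact: mem_smallest_star.
- exact: mem_smallest_star.
- exact: mem_smallest_star.
Qed.

Lemma norm2_increment s t : 0 <= s -> s < t ->
  norm2 (X t - X s) = Num.sqrt (t - s).
Proof.
move=> s0 st; apply: norm2_sqrt.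
rewrite increment_sa // ?(le_trans s0 (ltW st)) // -expr2.
by have [_ -> _] := increment_moments s t s0 st.
Qed.

(** Each increment of X is centered and free from the past: the sums are
    martingales. *)
Lemma ito_sum_centered Y s p c : 0 <= s -> path <%R s p -> F s c ->
  (forall r, s <= r -> F r (Y r)) -> tau A (c * left_sum X Y s p) = 0.
Proof.
elim: p s c => [|x p IHp] s c s0 /=; first by rewrite mulr0 linear0.
move=> /andP[sx xp] Fc FY; have x0 := le_trans s0 (ltW sx).
rewrite mulrDr linearD /= IHp //; last 2 first.
- exact: (F_mono _ _ _ s0 (ltW sx) Fc).
- by move=> r xr; apply: FY; exact: le_trans (ltW sx) xr.
rewrite addr0 mulrA tau_tracial mulrA; apply: increment_pair => //.
by apply: (ssubM _ (F_sub s s0)) => //; exact: FY.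
Qed.

(** Ito isometry: by the martingale property the terms are orthogonal, and
    tau (dX^2 Y Y^* ) = dt tau (Y Y^* ) by freeness. *)
Lemma ito_sum_norm2 Y s p (M : R) : 0 <= s -> path <%R s p ->
  (forall r, s <= r -> F r (Y r)) ->
  (forall r, s <= r <= last s p -> norm2 (Y r) ^+ 2 <= M) ->
  norm2 (left_sum X Y s p) ^+ 2 <= M * (last s p - s).
Proof.
elim: p s => [|x p IHp] s s0 /=.
  by move=> *; rewrite norm2_0 expr0n subrr mulr0.
move=> /andP[sx xp] FY YM; have x0 := le_trans s0 (ltW sx).
have FYx r : x <= r -> F r (Y r).
  by move=> xr; apply: FY; exact: le_trans (ltW sx) xr.
have xl := path_le_last _ _ xp.
have -> : norm2 ((X x - X s) * Y s + left_sum X Y x p) ^+ 2 =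
    (x - s) * norm2 (Y s) ^+ 2 + norm2 (left_sum X Y x p) ^+ 2.
  apply: complexI; rewrite [RHS]rmorphD /= [in RHS]rmorphM /= !norm2_sqr.
  set D := X x - X s; set S := left_sum _ _ _ _.
  have cross : tau A (star (D * Y s) * S) = 0.
    apply: ito_sum_centered => //; apply: ssub_star; first exact: F_sub.
    apply: (ssubM _ (F_sub x x0)); last by apply: F_mono (FY s _) => //; exact: ltW.
    apply: (ssubB _ (F_sub x x0)); first exact: F_X.
    by apply: F_mono (F_X s s0) => //; exact: ltW.
  rewrite starD mulrDl !mulrDr !linearD /= cross addr0.
  have -> : tau A (star S * (D * Y s)) = 0.
    by rewrite -[star S * _]starK tau_star starM starK cross rmorph0.
  rewrite add0r; congr (_ + _).
  rewrite starM increment_sa // mulrA -(mulrA (star (Y s))) -expr2.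
  rewrite tau_tracial mulrA increment_sqr_pair // ?[tau A (Y s * _)]tau_tracial //.
  by apply: (ssubM _ (F_sub s s0)); [|apply: (ssub_star _ (F_sub s s0))]; exact: FY.
have -> : M * (last x p - s) = (x - s) * M + M * (last x p - x) by ring.
apply: lerD; last first.
  apply: IHp => // r /andP[xr rl]; apply: YM.
  by rewrite rl (le_trans (ltW sx)).
by rewrite ler_pM2l ?subr_gt0 // YM // lexx (le_trans (ltW sx)).
Qed.

Lemma time_sum_norm2 Y s p (M : R) : path <%R s p ->
  (forall r, s <= r <= last s p -> norm2 (Y r) <= M) ->
  norm2 (left_sum clock Y s p) <= M * (last s p - s).
Proof.
elim: p s => [|x p IHp] s /=; first by move=> *; rewrite norm2_0 subrr mulr0.
move=> /andP[sx xp] YM; have xl := path_le_last _ _ xp.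
have -> : M * (last x p - s) = (x - s) * M + M * (last x p - x) by ring.
apply: le_trans (norm2D _ _) _; apply: lerD; last first.
  apply: IHp => // r /andP[xr rl]; apply: YM.
  by rewrite rl (le_trans (ltW sx)).
rewrite -scalerBl -scalerAl mul1r norm2Z -rmorphB /= cabs_real.
rewrite ger0_norm; last by rewrite subr_ge0 ltW.
by rewrite ler_pM2l ?subr_gt0 // YM // lexx (le_trans (ltW sx)).
Qed.

(** Subtract the equations at t and at s, along a fine partition of [0, t] that
    passes through s. *)
Lemma sde_increment s t e : 0 <= s -> s <= t -> 0 < e ->
  exists2 p, path <%R s p /\ last s p = t &
    norm2 (U t - U s - ('i *: left_sum X U s p -
                        2^-1 *: left_sum clock U s p)) <= e.
Proof.
move=> s0 st e0; have t0 := le_trans s0 st.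
have [J1 [J2 [iJ1 iJ2 Us]]] := sdeU s s0.
have [K1 [K2 [iK1 iK2 Ut]]] := sdeU t t0.
have e4 : 0 < e / 4 by lra.
have [d1 d10 H1] := ito_integral_fine _ _ _ _ _ iJ1 e4.
have [d2 d20 H2] := ito_integral_fine _ _ _ _ _ iJ2 e4.
have [d3 d30 H3] := ito_integral_fine _ _ _ _ _ iK1 e4.
have [d4 d40 H4] := ito_integral_fine _ _ _ _ _ iK2 e4.
pose d := Num.min (Num.min d1 d2) (Num.min d3 d4).
have d0 : 0 < d by rewrite !lt_min d10 d20 d30.
have [le1 le2 le3 le4] : [/\ d <= d1, d <= d2, d <= d3 & d <= d4].
  by rewrite !ge_min !lexx !orbT.
have [q pq lq] := fine_partition d 0 s d0 s0.
have [p pp lp] := fine_partition d s t d0 st.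
exists p; first by split => //; exact: fine_lt pp.
have pqp : path (fine d) 0 (q ++ p) by rewrite cat_path pq lq.
have lqp : last 0 (q ++ p) = t by rewrite last_cat lq.
have := H1 _ (fineS _ _ _ _ le1 pq) lq; have := H2 _ (fineS _ _ _ _ le2 pq) lq.
have := H3 _ (fineS _ _ _ _ le3 pqp) lqp; have := H4 _ (fineS _ _ _ _ le4 pqp) lqp.
rewrite !left_sum_cat lq.
set a1 := left_sum X U 0 q; set a2 := left_sum clock U 0 q.
set b1 := left_sum X U s p; set b2 := left_sum clock U s p => h4 h3 h2 h1.
have -> : U t - U s - ('i *: b1 - 2^-1 *: b2) =
   'i *: ((a1 - J1) - (a1 + b1 - K1)) - 2^-1 *: ((a2 - J2) - (a2 + b2 - K2)).
  have E (x y z w : A) : x - y - (x + z - w) = w - y - z.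
    by rewrite !opprD opprK (AC (2*(2*1)) ((1*3)*5*2*4)) /= subrr add0r.
  rewrite !E !scalerBr Ut Us.
  set j1 := 'i *: J1; set j2 := _ *: J2; set k1 := 'i *: K1; set k2 := _ *: K2.
  set c1 := 'i *: b1; set c2 := _ *: b2; set u0 := U 0.
  rewrite !opprD !opprK (AC ((3*3)*2) ((1*4)*((2*5*7)*(3*6*8)))) /=.
  by rewrite subrr add0r.
apply: le_trans (norm2B _ _) _; rewrite !norm2Z cabs_i mul1r.
have -> : cabs 2^-1 = 2^-1 :> R.
  by rewrite -(rmorph_nat (real_complex R)) -fmorphV /= cabs_real ger0_norm // invr_ge0.
have := norm2B (a1 - J1) (a1 + b1 - K1); have := norm2B (a2 - J2) (a2 + b2 - K2).
lra.
Qed.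

(** The drift has norm of order d^2 and the martingale part order d. *)
Lemma norm2_sde_increment s d : 0 <= s -> 0 < d -> d <= 1 ->
  norm2 (U (s + d ^+ 2) - U s) <= 3 / 2 * d.
Proof.
move=> s0 d0 d1.
have d2 : 0 < d ^+ 2 by rewrite exprn_gt0.
have d2d : d ^+ 2 <= d by rewrite expr2 ger_pMr.
apply/ler_addgt0Pr => e e0.
have sd : s <= s + d ^+ 2 by rewrite lerDl ltW.
have [p [pp lp] H] := sde_increment s (s + d ^+ 2) e s0 sd e0.
have st : last s p - s = d ^+ 2 by rewrite lp addrAC subrr add0r.
have n1 r : s <= r <= last s p -> norm2 (U r) = 1.
  by move=> /andP[sr _]; apply/norm2_unitary/unitU/(le_trans s0).
have S1 : norm2 (left_sum X U s p) <= d.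
  apply: norm2_le_sqr; first exact: ltW.
  rewrite -[leRHS]mul1r -st; apply: ito_sum_norm2 => //.
    by move=> r sr; exact/adU/(le_trans s0).
  by move=> r /n1 ->; rewrite expr1n.
have S2 : norm2 (left_sum clock U s p) <= d ^+ 2.
  rewrite -[leRHS]mul1r -st; apply: time_sum_norm2 => //.
  by move=> r /n1 ->.
rewrite -(subrK ('i *: left_sum X U s p - 2^-1 *: left_sum clock U s p) (_ - U s)).
have := norm2B ('i *: left_sum X U s p) (2^-1 *: left_sum clock U s p).
rewrite !norm2Z cabs_i cabs_half => H2.
apply: le_trans (norm2D _ _) _; lra.
Qed.

Lemma norm2_sde_increment_le s d r : 0 <= s -> 0 < d -> d <= 1 ->
  s <= r <= s + d ^+ 2 -> norm2 (U r - U s) <= 3 / 2 * d.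
Proof.
move=> s0 d0 d1 /andP[sr rd].
have [->|neq] := eqVneq r s; first by rewrite subrr norm2_0; lra.
have sr' : 0 < r - s by rewrite subr_gt0 lt_def neq.
pose d' := Num.sqrt (r - s).
have d'2 : d' ^+ 2 = r - s by rewrite sqr_sqrtr // ltW.
have d'd : d' <= d.
  by rewrite -(@ler_pXn2r _ 2) ?nnegrE ?sqrtr_ge0 ?(ltW d0) // d'2; lra.
have := norm2_sde_increment s d' s0 _ (le_trans d'd d1).
rewrite d'2 (addrC s) subrK sqrtr_gt0 => /(_ sr'); lra.
Qed.

(** From here on the time step is d^2, so that the increments of X and U have
    norm of order d, and an error is negligible when it is of order d^3. *)
Section Step.
Variables (s d : R).
Hypotheses (s0 : 0 <= s) (d0 : 0 < d) (d1 : d <= 1).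
Local Notation t := (s + d ^+ 2).
Let dX := X t - X s.
Let dU := U t - U s.
Let E := dU - 'i *: (dX * U s).

Let d2 : 0 < d ^+ 2. Proof. by rewrite exprn_gt0. Qed.
Let st : s < t. Proof. by rewrite ltrDl. Qed.
Let t0 : 0 <= t. Proof. exact: le_trans s0 (ltW st). Qed.
Let d2d : d ^+ 2 <= d. Proof. by rewrite expr2 ger_pMr. Qed.
Let uUs : unitary (U s). Proof. exact: unitU. Qed.
Let uUt : unitary (U t). Proof. exact: unitU. Qed.

Let norm2_dX : norm2 dX = d.
Proof. by rewrite norm2_increment // addrAC subrr add0r sqrtr_sqr gtr0_norm. Qed.

Let norm2_dU : norm2 dU <= 3 / 2 * d.
Proof. exact: norm2_sde_increment. Qed.

(** The stochastic integral of U r - U s, which has norm of order d, over a time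
    d^2 has norm of order d^2, and so has the drift. *)
Lemma norm2_sde_error : norm2 E <= 2 * d ^+ 2.
Proof.
apply/ler_addgt0Pr => e e0.
have [p [pp lp] H] := sde_increment s t e s0 (ltW st) e0.
have std : last s p - s = d ^+ 2 by rewrite lp addrAC subrr add0r.
have n1 r : s <= r <= last s p -> norm2 (U r - U s) <= 3 / 2 * d.
  by rewrite lp; exact: norm2_sde_increment_le.
have S1 : norm2 (left_sum X (fun r => U r - U s) s p) <= 3 / 2 * d ^+ 2.
  apply: norm2_le_sqr; first by have := d2; lra.
  have -> : (3 / 2 * d ^+ 2) ^+ 2 = (3 / 2 * d) ^+ 2 * (last s p - s).
    by rewrite std; ring.
  apply: ito_sum_norm2 => //.
    move=> r sr; apply: (ssubB _ (F_sub r (le_trans s0 sr))).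
      exact/adU/(le_trans s0).
    by apply: (F_mono _ _ _ s0 sr); exact: adU.
  by move=> r /n1 nr; rewrite ler_pXn2r ?nnegrE ?norm2_ge0 ?mulr_ge0 ?divr_ge0 ?(ltW d0).
have S2 : norm2 (left_sum clock U s p) <= d ^+ 2.
  rewrite -[leRHS]mul1r -std; apply: time_sum_norm2 => //.
  by move=> r /andP[sr _]; rewrite norm2_unitary //; exact/unitU/(le_trans s0).
rewrite left_sum_subr lp -/dX in S1.
set S := left_sum X U s p in H S1; set T := left_sum clock U s p in H S2.
have -> : E = (dU - ('i *: S - 2^-1 *: T)) + ('i *: (S - dX * U s) - 2^-1 *: T).
  rewrite scalerBr /E; set x := 'i *: S; set y := 'i *: _; set z := _ *: T.
  rewrite opprB [_ + (z - x)]addrA (AC (3*3) (1*5*(2*6)*(3*4))) /=.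
  by rewrite subrr addNr !addr0.
have := norm2B ('i *: (S - dX * U s)) (2^-1 *: T).
rewrite !norm2Z cabs_i cabs_half => H2.
apply: le_trans (norm2D _ _) _; lra.
Qed.

(** The martingale part is orthogonal to the past; the drift is -1/2 U s up to an
    error of order d in norm. *)
Lemma tau_sde_increment c : F s c -> unitary c ->
  cabs (tau A (c * dU) + (2^-1 * d ^+ 2)%:C * tau A (c * U s)) <= 3 / 4 * d ^+ 3.
Proof.
move=> Fc uc; apply/ler_addgt0Pr => e e0.
have [p [pp lp] H] := sde_increment s t e s0 (ltW st) e0.
have std : last s p - s = d ^+ 2 by rewrite lp addrAC subrr add0r.
have S2 : norm2 (left_sum clock (fun r => U r - U s) s p) <= 3 / 2 * d ^+ 3.
  have -> : 3 / 2 * d ^+ 3 = 3 / 2 * d * (last s p - s) by rewrite std; ring.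
  apply: time_sum_norm2 => // r; rewrite lp; exact: norm2_sde_increment_le.
have S1 : tau A (c * left_sum X U s p) = 0.
  by apply: ito_sum_centered => // r sr; exact/adU/(le_trans s0).
rewrite left_sum_subr lp -scalerBl -scalerAl mul1r in S2.
rewrite -rmorphB /= addrAC subrr add0r in S2.
set S := left_sum X U s p in H S1; set T := left_sum clock U s p in H S2.
have -> : tau A (c * dU) + (2^-1 * d ^+ 2)%:C * tau A (c * U s) =
   tau A (c * (dU - ('i *: S - 2^-1 *: T))) -
   2^-1 * tau A (c * (T - (d ^+ 2)%:C *: U s)).
  have -> : (2^-1 * d ^+ 2)%:C = 2^-1 * (d ^+ 2)%:C :> R[i].
    by rewrite [LHS]rmorphM /= fmorphV rmorph_nat.
  set q := (d ^+ 2)%:C; clearbody q dU.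
  rewrite !mulrBr -!scalerAr !linearB /= !tauZ S1.
  by ring.
apply: le_trans (cabsB _ _) _; rewrite cabsM cabs_half.
have := tau_CauchySchwarz c (dU - ('i *: S - 2^-1 *: T)).
have := tau_CauchySchwarz c (T - (d ^+ 2)%:C *: U s).
rewrite norm2_unitary //; lra.
Qed.

Let dUE : dU = E + 'i *: (dX * U s). Proof. by rewrite subrK. Qed.

(** Replace dU by i dX U s twice and use freeness of dX from the past. *)
Lemma tau_quadratic a c : F s a -> F s c -> unitary a -> unitary c ->
  cabs (tau A (dU * a * dU * c) + (d ^+ 2)%:C * (tau A (U s * a) * tau A (U s * c)))
    <= 5 * d ^+ 3.
Proof.
move=> Fa Fc ua uc; have FU := adU s s0.
have -> : tau A (dU * a * dU * c) =
    tau A (E * (a * dU * c)) + 'i * tau A (dX * (U s * a * E * c))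
    - (d ^+ 2)%:C * (tau A (U s * a) * tau A (U s * c)).
  rewrite (tau_expand _ _ _ _ _ dUE); set Y := 'i *: _; congr (_ + _ + _).
    by rewrite /Y -!scalerAl tauZ ?mulrA.
  rewrite /Y -scalerAr -!scalerAl !tauZ mulrA -expr2 sqrCi mulN1r; congr (- _).
  rewrite !mulrA -(mulrA dX) -(mulrA (dX * _ * _) (U s)).
  rewrite increment_quad //; last 2 first.
  - exact: (ssubM _ (F_sub s s0)).
  - exact: (ssubM _ (F_sub s s0)).
  by rewrite addrAC subrr add0r -mulrA.
rewrite subrK; apply: le_trans (cabsD _ _) _; rewrite cabsM cabs_i mul1r.
have := tau_CauchySchwarz E (a * dU * c); have := tau_CauchySchwarz dX (U s * a * E * c).
have uUa : unitary (U s * a) by exact: unitaryM.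
rewrite !(norm2_unitaryr c) // (norm2_unitaryl a) // (norm2_unitaryl (U s * a)) //.
have nE := norm2_sde_error; have := norm2_ge0 E; have := norm2_ge0 dU.
rewrite norm2_dX => h1 h2 h3 h4.
have h5 : norm2 E * norm2 dU <= 2 * d ^+ 2 * (3 / 2 * d) by apply: ler_pM.
have h6 : d * norm2 E <= d * (2 * d ^+ 2) by rewrite ler_pM2l.
rewrite exprS in h5 h6 *; lra.
Qed.

(** Two of the factors are replaced by i dX U s, and dX b dX has norm of order d^2
    by the fourth moment of dX; the third factor dU has norm of order d. *)
Lemma tau_cubic a b c : F s a -> F s b -> unitary a -> unitary b -> unitary c ->
  cabs (tau A (dU * a * dU * b * dU * c)) <= 13 * d ^+ 3.
Proof.
move=> Fa Fb ua ub uc; have FU := adU s s0.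
have -> : tau A (dU * a * dU * b * dU * c) =
    tau A (E * (a * dU * b * dU * c)) + 'i * tau A (dX * (U s * a * E * b * dU * c))
    - tau A ((dX * (U s * a) * dX) * (U s * b * dU * c)).
  rewrite -(mulrA _ b) -(mulrA _ _ c) (tau_expand _ _ _ _ _ dUE) !mulrA.
  set Y := 'i *: _; congr (_ + _ + _).
    by rewrite /Y -!scalerAl tauZ ?mulrA.
  by rewrite /Y -scalerAr -!scalerAl !tauZ mulrA -expr2 sqrCi mulN1r ?mulrA.
apply: le_trans (cabsB _ _) _; apply: le_trans (lerD (cabsD _ _) (lexx _)) _.
rewrite cabsM cabs_i mul1r.
have uUa : unitary (U s * a) by exact: unitaryM.
have uUb : unitary (U s * b) by exact: unitaryM.
(* As a difference of two unitaries, dU is a bounded multiplier of norm at most 2. *)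
have absorbl x : norm2 (dU * x) <= 2 * norm2 x.
  rewrite mulrBl; apply: le_trans (norm2B _ _) _.
  by rewrite (norm2_unitaryl (U t)) // (norm2_unitaryl (U s)) //; lra.
have absorbr x : norm2 (x * dU) <= 2 * norm2 x.
  rewrite mulrBr; apply: le_trans (norm2B _ _) _.
  by rewrite (norm2_unitaryr (U t)) // (norm2_unitaryr (U s)) //; lra.
have nXX : norm2 (dX * (U s * a) * dX) <= 2 * d ^+ 2.
  have sdX : star dX = dX by rewrite increment_sa.
  have uv := unitary_star _ uUa; set v := U s * a in uUa uv *.
  apply: norm2_le_sqr; first by rewrite mulr_ge0 // ltW.
  have nX2 : norm2 (dX ^+ 2) ^+ 2 = 2 * (d ^+ 2) ^+ 2.
    apply: complexI; rewrite norm2_sqr starX sdX -exprD.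
    have [_ _ ->] := increment_moments s t s0 st.
    by rewrite addrAC subrr add0r.
  have := tau_CauchySchwarz (dX ^+ 2 * star v) (dX ^+ 2 * v).
  rewrite (norm2_unitaryr v) // (norm2_unitaryr (star v)) // -expr2 nX2.
  have -> : tau A (dX ^+ 2 * star v * (dX ^+ 2 * v)) =
      (norm2 (dX * v * dX) ^+ 2)%:C.
    by rewrite norm2_sqr !starM sdX !mulrA [RHS]tau_tracial !expr2 !mulrA.
  rewrite cabs_real ger0_norm ?exprn_ge0 ?norm2_ge0 // => /le_trans; apply.
  by rewrite [leRHS]exprMn ler_pM2r ?exprn_gt0 //; lra.
have nE := norm2_sde_error; have E0 := norm2_ge0 E; have dU0 := norm2_ge0 dU.
have d20 := d2.
have T1 : cabs (tau A (E * (a * dU * b * dU * c))) <= 6 * d ^+ 3.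
  apply: le_trans (tau_CauchySchwarz _ _) _; rewrite (norm2_unitaryr c) // -!mulrA (norm2_unitaryl a) //.
  apply: (@le_trans _ _ (2 * d ^+ 2 * (3 * d))); last by rewrite (exprS d 2); lra.
  apply: ler_pM; rewrite ?norm2_ge0 //.
  by apply: le_trans (absorbl _) _; rewrite (norm2_unitaryl b) //; have := norm2_dU; lra.
have T2 : cabs (tau A (dX * (U s * a * E * b * dU * c))) <= 4 * d ^+ 3.
  apply: le_trans (tau_CauchySchwarz _ _) _; rewrite norm2_dX (norm2_unitaryr c) //.
  apply: (@le_trans _ _ (d * (4 * d ^+ 2))); last by rewrite (exprS d 2); lra.
  rewrite ler_pM2l //; apply: le_trans (absorbr _) _.
  by rewrite (norm2_unitaryr b) // (norm2_unitaryl (U s * a)) //; lra.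
have T3 : cabs (tau A ((dX * (U s * a) * dX) * (U s * b * dU * c))) <= 3 * d ^+ 3.
  apply: le_trans (tau_CauchySchwarz _ _) _; rewrite (norm2_unitaryr c) // (norm2_unitaryl (U s * b)) //.
  apply: (@le_trans _ _ (2 * d ^+ 2 * (3 / 2 * d))); last by rewrite (exprS d 2); lra.
  by apply: ler_pM; rewrite ?norm2_ge0.
lra.
Qed.

End Step.
End Ito.

(** * Rates of change and the moment equations *)

Section Rates.
Context {R : realType}.
Implicit Types (f g : R -> R[i]) (z : nat -> R[i]).

(** A quantitative form of f' = g on [0, oo[, uniform in time and with bounded f
    and g. The step is written d^2, so that the error d^3 is the natural one for
    Brownian increments. *)
Definition rate f g := exists C : R, forall s, 0 <= s ->
  [/\ cabs (f s) <= C, cabs (g s) <= C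
    & forall d, 0 < d -> d <= 1 ->
        cabs (f (s + d ^+ 2) - f s - (d ^+ 2)%:C * g s) <= C * d ^+ 3].

Lemma rate_ge0 f g : rate f g -> exists2 C : R, 0 <= C & forall s, 0 <= s ->
  [/\ cabs (f s) <= C, cabs (g s) <= C
    & forall d, 0 < d -> d <= 1 ->
        cabs (f (s + d ^+ 2) - f s - (d ^+ 2)%:C * g s) <= C * d ^+ 3].
Proof.
move=> [C H]; exists C => //.
by have [h _ _] := H 0 (lexx _); exact: le_trans (cabs_ge0 _) h.
Qed.

Lemma eq_rate f f' g g' : (forall s, 0 <= s -> f s = f' s) ->
  (forall s, 0 <= s -> g s = g' s) -> rate f g -> rate f' g'.
Proof.
move=> ff gg [C H]; exists C => s s0; have [h1 h2 h3] := H s s0.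
rewrite -ff // -gg //; split => // d d0 d1.
by rewrite -ff ?h3 // addr_ge0 // exprn_ge0 // ltW.
Qed.

Lemma rate_cst (c : R[i]) : rate (fun=> c) (fun=> 0).
Proof.
exists (cabs c) => s s0; rewrite cabs0 cabs_ge0; split => // d d0 d1.
by rewrite mulr0 subr0 subrr cabs0 mulr_ge0 ?cabs_ge0 // exprn_ge0 // ltW.
Qed.

Lemma rateD f1 f2 g1 g2 : rate f1 g1 -> rate f2 g2 ->
  rate (fun s => f1 s + f2 s) (fun s => g1 s + g2 s).
Proof.
move=> [C1 H1] [C2 H2]; exists (C1 + C2) => s s0.
have [a1 b1 c1] := H1 s s0; have [a2 b2 c2] := H2 s s0.
split.
- exact: le_trans (cabsD _ _) (lerD a1 a2).
- exact: le_trans (cabsD _ _) (lerD b1 b2).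
move=> d d0 d1; rewrite mulrDl; apply: le_trans (lerD (c1 d d0 d1) (c2 d d0 d1)).
apply: le_trans (cabsD _ _); rewrite le_eqVlt; apply/orP; left; apply/eqP.
by congr cabs; ring.
Qed.

Lemma rateM f1 f2 g1 g2 : rate f1 g1 -> rate f2 g2 ->
  rate (fun s => f1 s * f2 s) (fun s => g1 s * f2 s + f1 s * g2 s).
Proof.
move=> /rate_ge0[C1 C10 H1] /rate_ge0[C2 C20 H2]; exists (4 * (C1 * C2)) => s s0.
have C12 : 0 <= C1 * C2 by exact: mulr_ge0.
have [a1 b1 c1] := H1 s s0; have [a2 b2 c2] := H2 s s0.
have M x y : cabs x <= C1 -> cabs y <= C2 -> cabs (x * y) <= C1 * C2.
  by move=> hx hy; rewrite cabsM ler_pM ?cabs_ge0.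
split.
- by have := M _ _ a1 a2; lra.
- by apply: le_trans (cabsD _ _) _; have := M _ _ b1 a2; have := M _ _ a1 b2; lra.
move=> d d0 d1; have {}c1 := c1 d d0 d1; have {}c2 := c2 d d0 d1.
have d30 : 0 < d ^+ 3 by rewrite exprn_gt0.
have d20 : 0 < d ^+ 2 by rewrite exprn_gt0.
have d32 : d ^+ 3 <= d ^+ 2 by rewrite exprS ger_pMl.
have d21 : d ^+ 2 <= d by rewrite expr2 ger_pMr.
have sd0 : 0 <= s + d ^+ 2 by rewrite addr_ge0 // ltW.
have [a1' _ _] := H1 _ sd0.
set x1 := f1 (s + _) in c1 a1' *; set x2 := f2 (s + _) in c2 *.
have -> : x1 * x2 - f1 s * f2 s - (d ^+ 2)%:C * (g1 s * f2 s + f1 s * g2 s) =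
    x1 * (x2 - f2 s - (d ^+ 2)%:C * g2 s) +
    (x1 - f1 s - (d ^+ 2)%:C * g1 s) * f2 s +
    (d ^+ 2)%:C * g2 s * ((x1 - f1 s - (d ^+ 2)%:C * g1 s) + (d ^+ 2)%:C * g1 s).
  by ring.
apply: le_trans (cabsD _ _) _; apply: le_trans (lerD (cabsD _ _) (lexx _)) _.
have cd : cabs (d ^+ 2)%:C = d ^+ 2 by rewrite cabs_real gtr0_norm.
have t1 : cabs (x1 * (x2 - f2 s - (d ^+ 2)%:C * g2 s)) <= C1 * C2 * d ^+ 3.
  by rewrite cabsM -mulrA ler_pM ?cabs_ge0.
have t2 : cabs ((x1 - f1 s - (d ^+ 2)%:C * g1 s) * f2 s) <= C1 * C2 * d ^+ 3.
  by rewrite cabsM mulrAC ler_pM ?cabs_ge0.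
have t3 : cabs (x1 - f1 s - (d ^+ 2)%:C * g1 s + (d ^+ 2)%:C * g1 s) <= 2 * C1 * d.
  apply: le_trans (cabsD _ _) _; rewrite cabsM cd.
  have h : d ^+ 2 * cabs (g1 s) <= d * C1.
    by rewrite ler_pM ?cabs_ge0 // ltW.
  have h' : C1 * d ^+ 3 <= C1 * d by rewrite ler_wpM2l // (le_trans d32).
  lra.
have t4 : cabs ((d ^+ 2)%:C * g2 s * (x1 - f1 s - (d ^+ 2)%:C * g1 s + (d ^+ 2)%:C * g1 s))
    <= (d ^+ 2 * C2) * (2 * C1 * d).
  by rewrite cabsM ler_pM ?cabs_ge0 // cabsM cd ler_pM2l.
have E : (d ^+ 2 * C2) * (2 * C1 * d) = 2 * (C1 * C2 * d ^+ 3) by ring.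
lra.
Qed.

Lemma rateZ (c : R[i]) f g : rate f g -> rate (fun s => c * f s) (fun s => c * g s).
Proof.
move=> fg; apply: eq_rate (rateM _ _ _ _ (rate_cst c) fg) => // s s0.
by rewrite mul0r add0r.
Qed.

Lemma rateB f1 f2 g1 g2 : rate f1 g1 -> rate f2 g2 ->
  rate (fun s => f1 s - f2 s) (fun s => g1 s - g2 s).
Proof.
move=> r1 /(rateZ (-1)) r2; apply: eq_rate (rateD _ _ _ _ r1 r2) => s s0;
by rewrite mulN1r.
Qed.

Lemma rate_conj f g : rate f g -> rate (fun s => (f s)^*) (fun s => (g s)^*).
Proof.
move=> [C H]; exists C => s /H[h1 h2 h3]; rewrite !cabsJ; split => // d d0 d1.
have := h3 d d0 d1; rewrite -cabsJ !rmorphB rmorphM /=.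
by rewrite [_%:C^*]conjc_real.
Qed.

(** Cut [0, t] into steps of length d^2: each step multiplies the modulus of f by
    at most 1 and adds an error C d^3, in total C t d, which tends to 0 with d. *)
Lemma rate_decay f (k : R) : 0 <= k -> rate f (fun s => - (k%:C * f s)) ->
  f 0 = 0 -> forall t, 0 <= t -> f t = 0.
Proof.
move=> k0 /rate_ge0[C C0 H] f0 t t0; apply: cabs_eq0; apply/eqP.
rewrite eq_le cabs_ge0 andbT.
have step d n : 0 < d -> d <= 1 -> k * d ^+ 2 <= 1 ->
    cabs (f (n%:R * d ^+ 2)) <= n%:R * (C * d ^+ 3).
  move=> d0 d1 kd; elim: n => [|n IHn]; first by rewrite !mul0r f0 cabs0.
  have n0 : 0 <= n%:R * d ^+ 2 by rewrite mulr_ge0 // exprn_ge0 // ltW.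
  have [_ _ /(_ d d0 d1)] := H _ n0.
  rewrite -natr1 !mulrDl !mul1r; set a := f _; set b := f (_ * _) => h.
  have -> : a = (a - b - (d ^+ 2)%:C * - (k%:C * b)) + (1 - k * d ^+ 2)%:C * b.
    have -> : (1 - k * d ^+ 2)%:C = 1 - k%:C * (d ^+ 2)%:C :> R[i].
      by rewrite [LHS]rmorphB rmorph1 [in LHS]rmorphM.
    by ring.
  apply: le_trans (cabsD _ _) _; rewrite addrC; apply: lerD => //.
  apply: le_trans IHn; rewrite cabsM cabs_real ger0_norm ?subr_ge0 //.
  by rewrite ler_piMl ?cabs_ge0 // gerBl mulr_ge0 // exprn_ge0 // ltW.
have key e : 0 < e -> e <= 1 -> k * e <= 1 -> cabs (f t) <= C * t * e.
  move=> e0 e1 ke; have [->|t_neq] := eqVneq t 0.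
    by rewrite f0 cabs0 mulr0 mul0r.
  have t_gt0 : 0 < t by rewrite lt_def t_neq.
  have e20 : 0 < e ^+ 2 by rewrite exprn_gt0.
  pose n := Num.Def.archi_bound (t / e ^+ 2).
  have te : t / e ^+ 2 < n%:R by rewrite archi_boundP // divr_ge0 // ltW.
  have n0 : 0 < n%:R :> R by apply: le_lt_trans te; rewrite divr_ge0 // ltW.
  pose d := Num.sqrt (t / n%:R).
  have d2 : d ^+ 2 = t / n%:R by rewrite sqr_sqrtr // divr_ge0 // ltW.
  have d0 : 0 < d by rewrite sqrtr_gt0 divr_gt0.
  have de : d <= e.
    rewrite -(@ler_pXn2r _ 2) ?nnegrE ?(ltW d0) ?(ltW e0) // d2.
    by rewrite ler_pdivrMr // mulrC -ler_pdivrMr // ltW.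
  have d1 : d <= 1 by exact: le_trans de e1.
  have kd : k * d ^+ 2 <= 1.
    apply: le_trans ke; rewrite ler_wpM2l //; apply: le_trans de.
    by rewrite expr2 ger_pMr.
  have tE : n%:R * d ^+ 2 = t by rewrite d2 mulrC divfK // gt_eqF.
  have := step d n d0 d1 kd; rewrite tE => /le_trans; apply.
  have -> : n%:R * (C * d ^+ 3) = C * (n%:R * d ^+ 2) * d by ring.
  by rewrite tE ler_wpM2l // mulr_ge0.
(* A step x <= 1 with k x <= 1 and C t x <= e. *)
have k1 : 0 < k + 1 by lra.
apply/ler_addgt0Pr => e e0; rewrite add0r.
have Ct : 0 <= C * t by exact: mulr_ge0.
have q0 : 0 < (k + 1) * (C * t + e + 1) by rewrite mulr_gt0 //; lra.
pose x := e / ((k + 1) * (C * t + e + 1)).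
have x0 : 0 < x by rewrite divr_gt0.
have kCt : 0 <= k * (C * t) by exact: mulr_ge0.
have ke : 0 <= k * e by rewrite mulr_ge0 // ltW.
have xq : x * ((k + 1) * (C * t + e + 1)) = e by rewrite divfK // gt_eqF.
have x1 : x <= 1 by rewrite ler_pdivrMr // mul1r; lra.
have kx : k * x <= 1 by rewrite mulrA ler_pdivrMr // mul1r; lra.
apply: le_trans (key x x0 x1 kx) _.
rewrite mulrA ler_pdivrMr // [leRHS]mulrC ler_wpM2r ?ltW //; lra.
Qed.

(** Slowing down time: a step d^2 becomes a step d^2 / 2, again at most 1. *)
Lemma rate_half f g : rate f g ->
  rate (fun s => f (s / 2)) (fun s => 2^-1 * g (s / 2)).
Proof.
move=> /rate_ge0[C C0 H]; exists C => s s0.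
have s20 : 0 <= s / 2 by rewrite divr_ge0.
have [h1 h2 h3] := H _ s20; split => //.
  by rewrite cabsM cabs_half; lra.
move=> d d0 d1; pose d' := Num.sqrt (d ^+ 2 / 2).
have d20 : 0 < d ^+ 2 by rewrite exprn_gt0.
have d'2 : d' ^+ 2 = d ^+ 2 / 2 by rewrite sqr_sqrtr // divr_ge0 // ltW.
have d'0 : 0 < d' by rewrite sqrtr_gt0 divr_gt0.
have d'd : d' <= d.
  by rewrite -(@ler_pXn2r _ 2) ?nnegrE ?(ltW d0) ?(ltW d'0) // d'2; lra.
have := h3 d' d'0 (le_trans d'd d1); rewrite d'2 -mulrDl.
have -> : (d ^+ 2 / 2)%:C * g (s / 2) = (d ^+ 2)%:C * (2^-1 * g (s / 2)).
  by rewrite [(d ^+ 2 / 2)%:C]rmorphM /= fmorphV rmorph_nat mulrA.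
move=> /le_trans; apply; rewrite ler_wpM2l //.
by rewrite ler_pXn2r ?nnegrE ?(ltW d0) ?(ltW d'0).
Qed.

(** The right-hand side of the moment equations
      z_n' = - k (n/2) z_n - k (n/2) sum_(0 < p < n) z_p z_(n-p)
    of a free multiplicative Brownian motion run at speed k, in the unsymmetrized
    form in which words produce it: a letter l, and a later letter at distance
    j + 1 contracted with it. *)
Definition moment_rate (k : R[i]) n z : R[i] :=
  - \sum_(l < n) (k / 2 * z n +
      \sum_(j < n.-1 - l) k * (z j.+1 * z (n.-1 - j)%N)).

Lemma moment_rateE (k : R[i]) n z :
  moment_rate k n z = - (n%:R * (k / 2 * z n) +
    \sum_(l < n) \sum_(j < n.-1 - l) k * (z j.+1 * z (n.-1 - j)%N)).
Proof.
by rewrite /moment_rate big_split /= sumr_const card_ord -[_ *+ n]mulr_natl.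
Qed.

Lemma moment_rateZ (c k : R[i]) n z :
  c * moment_rate k n z = moment_rate (c * k) n z.
Proof.
rewrite /moment_rate mulrN mulr_sumr; congr (- _); apply: eq_bigr => l _.
rewrite mulrDr mulr_sumr; congr (_ + _); first by rewrite !mulrA.
by apply: eq_bigr => j _; ring.
Qed.

Lemma moment_rate_conj (k : R) n z :
  (moment_rate k%:C n z)^* = moment_rate k%:C n (fun i => (z i)^*).
Proof.
have kJ : (k%:C)^* = k%:C by exact: conjc_real.
have cM (x y : R[i]) : (x * y)^* = x^* * y^* by exact: rmorphM.
have cV : (2^-1)^* = 2^-1 :> R[i] by rewrite fmorphV rmorph_nat.
have cS m (f : 'I_m -> R[i]) : (\sum_(i < m) f i)^* = \sum_(i < m) (f i)^*.
  exact: rmorph_sum.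
have cD (x y : R[i]) : (x + y)^* = x^* + y^* by exact: rmorphD.
have cN (x : R[i]) : (- x)^* = - x^* by exact: rmorphN.
rewrite /moment_rate cN cS; congr (- _); apply: eq_bigr => l _.
rewrite cD cS !cM kJ cV; congr (_ + _).
by apply: eq_bigr => j _; rewrite !cM kJ.
Qed.

(** The system is triangular: the n-th equation is linear in the n-th unknown
    once the lower moments are known. *)
Lemma moment_rate_unique (u w : nat -> R -> R[i]) :
  (forall n, rate (u n) (fun s => moment_rate 1 n (u ^~ s))) ->
  (forall n, rate (w n) (fun s => moment_rate 1 n (w ^~ s))) ->
  (forall n, u n 0 = w n 0) -> forall n t, 0 <= t -> u n t = w n t.
Proof.
move=> ru rw uw0 n t t0; elim/ltn_ind: n t t0 => n IHn.
suff rd : rate (fun s => u n s - w n s) (fun s => - ((n%:R / 2)%:C * (u n s - w n s))).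
  move=> t t0; apply/eqP; rewrite -subr_eq0; apply/eqP.
  apply: (rate_decay (fun s => u n s - w n s) _ _ rd) => //.
  by rewrite uw0 subrr.
apply: eq_rate (rateB _ _ _ _ (ru n) (rw n)) => // s s0.
have nE : (n%:R / 2)%:C = n%:R * (1 / 2) :> R[i].
  by rewrite [LHS]rmorphM /= fmorphV !rmorph_nat mul1r.
rewrite !moment_rateE nE.
set Su := \sum_(l < n) _; set Sw := \sum_(l < n) _.
suff -> : Su = Sw by ring.
apply: eq_bigr => l _; apply: eq_bigr => j _; congr (_ * _).
have [ln jn] := (ltn_ord l, ltn_ord j).
by congr (_ * _); apply: IHn => //; lia.
Qed.

End Rates.

(** * Moments of free unitary Brownian motion *)

Section PowerMoments.
Context {R : realType} {A : tracialWStarSpace R}.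
Variables (F : R -> set A) (X U : R -> A).
Hypothesis filtF : filtration F.
Hypothesis bmX : free_brownian_motion F X.
Hypothesis adU : adapted F U.
Hypothesis sdeU : solves_unitary_sde X U.
Hypothesis unitU : forall t, 0 <= t -> unitary (U t).

Lemma pow_telescope (u v : A) n :
  v ^+ n - u ^+ n = \sum_(l < n) u ^+ l * (v - u) * v ^+ (n.-1 - l).
Proof.
elim: n => [|n IHn]; first by rewrite !expr0 subrr big_ord0.
rewrite big_ord_recl /= expr0 mul1r subn0.
have -> : \sum_(l < n) u ^+ bump 0 l * (v - u) * v ^+ (n - bump 0 l) =
    u * (v ^+ n - u ^+ n).
  rewrite IHn mulr_sumr; apply: eq_bigr => l _.
  rewrite /bump add1n exprS !mulrA; congr (_ * v ^+ _).
  by have := ltn_ord l; lia.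
by rewrite mulrBl mulrBr -!exprS addrA subrK.
Qed.

(** Expand the increment of the n-th power by telescoping twice more, which
    isolates the terms linear and quadratic in dU with coefficients in the past,
    and leaves a cubic remainder. *)
Lemma power_moment_step n s d : 0 <= s -> 0 < d -> d <= 1 ->
  cabs (tau A (U (s + d ^+ 2) ^+ n) - tau A (U s ^+ n) -
        (d ^+ 2)%:C * moment_rate 1 n (fun k => tau A (U s ^+ k))) <=
  (\sum_(l < n) (3 / 4 + \sum_(j < n.-1 - l)
     (5 + \sum_(i < (n.-1 - l).-1 - j) 13))) * d ^+ 3.
Proof.
move=> s0 d0 d1; set V := U (s + _); set u := U s.
have Fu k : F s (u ^+ k) by apply: ssubX (adU s s0); case: filtF => + _ => /(_ s s0)[].
have uu k : unitary (u ^+ k) by exact/unitaryX/unitU.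
have uV k : unitary (V ^+ k).
  by apply/unitaryX/unitU; rewrite addr_ge0 // exprn_ge0 // ltW.
have -> : tau A (V ^+ n) - tau A (u ^+ n) =
    \sum_(l < n) tau A (V ^+ (n.-1 - l) * u ^+ l * (V - u)).
  rewrite -linearB /= pow_telescope linear_sum /=; apply: eq_bigr => l _.
  by rewrite [LHS]tau_tracial mulrA.
rewrite /moment_rate mulrN opprK mulr_sumr -big_split /= mulr_suml.
apply: le_trans (cabs_sum _ _ _) _; apply: ler_sum => l _.
have ln := ltn_ord l.
set m := (n.-1 - l)%N; have mn : (m + l)%N = n.-1 by rewrite subnK //; lia.
have -> : tau A (V ^+ m * u ^+ l * (V - u)) = tau A (u ^+ n.-1 * (V - u)) +
  \sum_(j < m) tau A ((V - u) * u ^+ j * (V - u) * (V ^+ (m.-1 - j) * u ^+ l)).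
  rewrite -[V ^+ m](subrK (u ^+ m)) [_ + u ^+ m]addrC pow_telescope.
  rewrite !mulrDl linearD /= -exprD mn; congr (_ + _).
  rewrite !mulr_suml linear_sum /=; apply: eq_bigr => j _.
  by rewrite [LHS]tau_tracial !mulrA.
rewrite [_%:C * _]mulrDr mulr_sumr addrACA -big_split /= [leRHS]mulrDl mulr_suml.
apply: le_trans (cabsD _ _) _; apply: lerD.
  have := tau_sde_increment F X U filtF bmX adU sdeU unitU s d s0 d0 d1
    (u ^+ n.-1) (Fu _) (uu _).
  rewrite -exprSr prednK; last by lia.
  rewrite [(2^-1 * _)%:C]rmorphM /= fmorphV rmorph_nat -/V -/u.
  by rewrite mul1r [_ * (2^-1 * _)]mulrCA mulrA.
apply: le_trans (cabs_sum _ _ _) _; apply: ler_sum => j _.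
have jm := ltn_ord j.
set q := (m.-1 - j)%N; have qm : (q + j)%N = m.-1 by rewrite subnK //; lia.
have -> : tau A ((V - u) * u ^+ j * (V - u) * (V ^+ q * u ^+ l)) =
   tau A ((V - u) * u ^+ j * (V - u) * u ^+ (q + l)) +
  \sum_(i < q) tau A ((V - u) * u ^+ j * (V - u) * u ^+ i * (V - u) *
     (V ^+ (q.-1 - i) * u ^+ l)).
  rewrite -[V ^+ q](subrK (u ^+ q)) [_ + u ^+ q]addrC pow_telescope.
  set w := V - u; clearbody w; rewrite mulrDl mulrDr linearD /= -exprD; congr (_ + _).
  rewrite mulr_suml mulr_sumr linear_sum /=; apply: eq_bigr => i _.
  by rewrite !mulrA.
rewrite addrAC [leRHS]mulrDl mulr_suml; apply: le_trans (cabsD _ _) _; apply: lerD.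
  have := tau_quadratic F X U filtF bmX adU sdeU unitU s d s0 d0 d1
    (u ^+ j) (u ^+ (q + l)) (Fu _) (Fu _) (uu _) (uu _).
  rewrite -/V -/u -!exprS mul1r; congr (cabs (_ + _ * (_ * tau A (_ ^+ _))) <= _).
  by lia.
apply: le_trans (cabs_sum _ _ _) _; apply: ler_sum => i _.
exact: (tau_cubic F X U filtF bmX adU sdeU unitU s d s0 d0 d1
    (u ^+ j) (u ^+ i) _ (Fu _) (Fu _) (uu _) (uu _) (unitaryM _ _ (uV _) (uu _))).
Qed.

Lemma rate_power n : rate (fun s => tau A (U s ^+ n))
  (fun s => moment_rate 1 n (fun k => tau A (U s ^+ k))).
Proof.
pose C1 : R := \sum_(l < n) (3 / 4 + \sum_(j < n.-1 - l)
     (5 + \sum_(i < (n.-1 - l).-1 - j) 13)).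
have C10 : 0 <= C1.
  apply: sumr_ge0 => l _; rewrite addr_ge0 ?divr_ge0 //.
  by apply: sumr_ge0 => j _; rewrite addr_ge0 // sumr_ge0.
pose C2 : R := \sum_(l < n) (2^-1 + \sum_(j < n.-1 - l) 1).
have C20 : 0 <= C2.
  by apply: sumr_ge0 => l _; rewrite addr_ge0 ?invr_ge0 // sumr_ge0.
exists (1 + C1 + C2) => s s0.
have m1 k : cabs (tau A (U s ^+ k)) <= 1.
  exact/cabs_tau_unitary/unitaryX/unitU.
split; first by have := m1 n; lra.
- suff : cabs (moment_rate 1 n (fun k => tau A (U s ^+ k))) <= C2 by lra.
  rewrite /moment_rate cabsN; apply: le_trans (cabs_sum _ _ _) _.
  apply: ler_sum => l _; apply: le_trans (cabsD _ _) _; apply: lerD.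
    by rewrite mul1r cabsM cabs_half; have := m1 n; lra.
  apply: le_trans (cabs_sum _ _ _) _; apply: ler_sum => j _.
  rewrite mul1r cabsM -[leRHS]mulr1; apply: ler_pM; rewrite ?cabs_ge0 //; exact: m1.
move=> d d0 d1; apply: le_trans (power_moment_step n s d s0 d0 d1) _.
rewrite -/C1 ler_wpM2r ?exprn_ge0 ?(ltW d0) //; lra.
Qed.

End PowerMoments.

(** * Second-order calculus of words *)

Lemma half_half {R : realType} {V : lmodType R[i]} (a : V) :
  2^-1 *: a + 2^-1 *: a = a.
Proof. by rewrite -scalerDl (_ : 2^-1 + 2^-1 = 1) ?scale1r //; field. Qed.

Section Fock.
Context {R : realType} {A : tracialWStarSpace R}.

(** Words in a unitary u and constants are evaluated under the perturbation
    u |-> exp(i d x) u, with x semicircular and free from u and the constants, up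
    to order d^2. Each u produces i x at the cut before it, each u^* produces - i x
    at the cut after it. A state records, for the word read so far from the right:
    - its value;
    - its probe, the contraction of one of its x with an x standing further left,
      the word in between being completed by y: the sum over the cuts w = w1 w2 of
      +- i tau (y w1) w2;
    - its drift, the coefficient of d^2 after the contractions
      x e x |-> tau e.
    Letters act on states from the left. *)
Definition state : Type := (A * (A -> A) * A)%type.

Definition value (s : state) : A := s.1.1.
Definition probe (s : state) : A -> A := s.1.2.
Definition drift (s : state) : A := s.2.
Definition vacuum : state := (1, fun=> 0, 0).

Lemma state_eq (s s' : state) : value s = value s' -> probe s =1 probe s' ->
  drift s = drift s' -> s = s'.
Proof.
case: s s' => [[a K] d] [[a' K'] d']; rewrite /value /probe /drift /= => -> KK ->.
by have -> : K = K' by apply/funext.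
Qed.

Definition op_const (b : A) (s : state) : state :=
  (b * value s, fun y => probe s (y * b), b * drift s).

Variable u : A.

Definition op_u (s : state) : state :=
  (u * value s,
   fun y => ('i * tau A y) *: (u * value s) + probe s (y * u),
   u * drift s - 2^-1 *: (u * value s) + 'i *: probe s u).

Definition op_ustar (s : state) : state :=
  (star u * value s,
   fun y => probe s (y * star u) - ('i * tau A (y * star u)) *: value s,
   star u * drift s - 2^-1 *: (star u * value s) - 'i *: (star u * probe s 1)).

Definition op_letter (c : bool) := if c then op_u else op_ustar.

Definition op_word (w : seq bool) (s : state) : state := foldr op_letter s w.

Lemma value_const b s : value (op_const b s) = b * value s. Proof. by []. Qed.
Lemma probe_const b s y : probe (op_const b s) y = probe s (y * b). Proof. by []. Qed.
Lemma drift_const b s : drift (op_const b s) = b * drift s. Proof. by []. Qed.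

Lemma value_u s : value (op_u s) = u * value s. Proof. by []. Qed.
Lemma probe_u s y : probe (op_u s) y =
  ('i * tau A y) *: (u * value s) + probe s (y * u).
Proof. by []. Qed.
Lemma drift_u s : drift (op_u s) =
  u * drift s - 2^-1 *: (u * value s) + 'i *: probe s u.
Proof. by []. Qed.

Lemma value_ustar s : value (op_ustar s) = star u * value s. Proof. by []. Qed.
Lemma probe_ustar s y : probe (op_ustar s) y =
  probe s (y * star u) - ('i * tau A (y * star u)) *: value s.
Proof. by []. Qed.
Lemma drift_ustar s : drift (op_ustar s) =
  star u * drift s - 2^-1 *: (star u * value s) - 'i *: (star u * probe s 1).
Proof. by []. Qed.

Definition stateE := ((value_const, probe_const, drift_const),
  (value_u, probe_u, drift_u), (value_ustar, probe_ustar, drift_ustar)).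

Lemma op_const1 s : op_const 1 s = s.
Proof. by apply: state_eq => [|y|]; rewrite !stateE ?mul1r ?mulr1. Qed.

Lemma op_constM b b' s : op_const b (op_const b' s) = op_const (b * b') s.
Proof. by apply: state_eq => [|y|]; rewrite !stateE ?mulrA. Qed.

Definition word_value (w : seq bool) : A :=
  foldr (fun (c : bool) a => (if c then u else star u) * a) 1 w.

(** The operators are linear in the state; an extra summand a of the drift is
    transported like an ordinary element. *)
Definition state_split (k : R[i]) (s s1 s2 : state) (a : A) :=
  [/\ value s = value s1 + k *: value s2,
      forall y, probe s y = probe s1 y + k *: probe s2 y
    & drift s = drift s1 + k *: drift s2 + a].

Lemma split_const k b s s1 s2 a : state_split k s s1 s2 a ->
  state_split k (op_const b s) (op_const b s1) (op_const b s2) (b * a).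
Proof.
move=> [ev ep ed]; split=> [|y|]; rewrite !stateE ?ev ?ep ?ed //.
  by rewrite mulrDr scalerAr.
by rewrite !mulrDr scalerAr.
Qed.

Lemma split_letter k (c : bool) s s1 s2 a : state_split k s s1 s2 a ->
  state_split k (op_letter c s) (op_letter c s1) (op_letter c s2)
    ((if c then u else star u) * a).
Proof.
move=> [ev ep ed]; case: c; split=> [|y|]; rewrite /op_letter !stateE ?ev ?ep ?ed.
- by rewrite mulrDr scalerAr.
- rewrite mulrDr -scalerAr !scalerDr !scalerA [k * _]mulrC.
  by rewrite addrACA.
- rewrite !mulrDr -!scalerAr !scalerDr scalerN !scalerA !opprD.
  by rewrite [k * 'i]mulrC [k * 2^-1]mulrC (AC ((3*2)*2) ((1*4*6)*(2*5*7)*3)).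
- by rewrite mulrDr scalerAr.
- rewrite !scalerDr scalerN !scalerA [k * _]mulrC opprD.
  by rewrite addrACA.
- rewrite !mulrDr -!scalerAr !scalerDr !scalerN !scalerA !opprD.
  by rewrite [k * 'i]mulrC [k * 2^-1]mulrC (AC ((3*2)*2) ((1*4*6)*(2*5*7)*3)).
Qed.

Lemma split_word k w s s1 s2 a : state_split k s s1 s2 a ->
  state_split k (op_word w s) (op_word w s1) (op_word w s2) (word_value w * a).
Proof.
move=> sp; elim: w => [|c w IHw] /=; first by rewrite mul1r.
by rewrite -mulrA; exact: split_letter.
Qed.

Lemma value_op_word w s : value (op_word w s) = word_value w * value s.
Proof.
elim: w => [|c w IHw] /=; first by rewrite mul1r.
by rewrite -mulrA -IHw; case: c.
Qed.

Definition word_probe w := probe (op_word w vacuum).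
Definition word_drift w := drift (op_word w vacuum).

Lemma probe_op_word w s y : probe (op_word w s) y =
  word_probe w y * value s + probe s (y * word_value w).
Proof.
rewrite /word_probe.
elim: w y => [|c w IHw] y /=; first by rewrite mul0r add0r mulr1.
case: c => /=; rewrite !stateE !value_op_word IHw mulr1.
  by rewrite mulrDl -!scalerAl -!mulrA addrA.
by rewrite mulrBl -!scalerAl -!mulrA addrAC.
Qed.

Hypothesis unitu : unitary u.
Let u1 : star u * u = 1. Proof. by case: unitu. Qed.
Let u2 : u * star u = 1. Proof. by case: unitu. Qed.

(** The perturbation keeps u unitary; accordingly the two letters act by mutually
    inverse operators, so that unreduced words cause no harm. *)
Lemma op_u_ustar s : op_u (op_ustar s) = s.
Proof.
apply: state_eq => [|y|]; rewrite !stateE.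
- by rewrite mulrA u2 mul1r.
- by rewrite mulrA u2 mul1r -mulrA u2 mulr1 addrC subrK.
- rewrite u2 tau1 mulr1 !mulrBr -!scalerAr !mulrA u2 !mul1r scalerBr scalerA.
  rewrite -expr2 sqrCi scaleN1r opprK.
  rewrite (AC (4*2) (1*(2*4)*(3*5)*6)) /= -opprD half_half.
  by rewrite addNr addr0 subrK.
Qed.

Lemma op_ustar_u s : op_ustar (op_u s) = s.
Proof.
apply: state_eq => [|y|]; rewrite !stateE.
- by rewrite mulrA u1 mul1r.
- by rewrite -mulrA u1 mulr1 addrAC subrr add0r.
- rewrite tau1 mulr1 !(mulrBr, mulrDr) -!scalerAr !mulrA u1 !mul1r scalerDr scalerA.
  rewrite -expr2 sqrCi scaleN1r opprD opprK.
  by rewrite (AC (4*2) (1*(2*4)*5*(3*6))) /= -opprD half_half subrr addr0 subrK.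
Qed.

End Fock.

(** * Periodic words *)

Section Words.
Context {R : realType} {A : tracialWStarSpace R}.

(** Adjacent mutually inverse letters cancel one after the other. *)
Lemma op_word_reduced (w : seq bool) : exists n c, forall u : A, unitary u ->
  forall s, op_word u w s = op_word u (nseq n c) s.
Proof.
elim: w => [|b w [n [c IHw]]]; first by exists 0%N, true.
have [bc|bc] := eqVneq b c.
  by exists n.+1, c => u uu s /=; rewrite IHw // bc.
case: n IHw => [|n] IHw.
  by exists 1%N, b => u uu s /=; rewrite IHw.
exists n, c => u uu s /=; rewrite IHw //=.
case: b c bc {IHw} => [] [] //= _; first by rewrite op_u_ustar.
by rewrite op_ustar_u.
Qed.

Lemma word_value_nseq (u : A) n c :
  word_value u (nseq n c) = (if c then u else star u) ^+ n.
Proof. by elim: n => //= n ->; rewrite exprS. Qed.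

(** Here d l is the drift of the word T^l, with T of value Z: the recursion contracts the leftmost period
    with each of the following ones. *)
Lemma drift_power (Z : A) (k : R[i]) (d : nat -> A) : d 0%N = 0 ->
  (forall l, d l.+1 = Z * d l - (k / 2) *: Z ^+ l.+1 -
     \sum_(j < l) (k * tau A (Z ^+ j.+1)) *: Z ^+ (l - j)) ->
  forall n, tau A (d n) = moment_rate k n (fun m => tau A (Z ^+ m)).
Proof.
move=> d0 dS n.
suff H m : tau A (Z ^+ m * d n) = - \sum_(l < n) (k / 2 * tau A (Z ^+ (n + m)) +
    \sum_(j < n.-1 - l) k * (tau A (Z ^+ j.+1) * tau A (Z ^+ (n.-1 - j + m)))).
  rewrite -[d n]mul1r -(expr0 Z) H /moment_rate; congr (- _).
  by apply: eq_bigr => l _; rewrite addn0; under eq_bigr do rewrite addn0.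
elim: n m => [|n IHn] m; first by rewrite d0 mulr0 linear0 big_ord0 oppr0.
have e1 : tau A (Z ^+ m * \sum_(j < n) (k * tau A (Z ^+ j.+1)) *: Z ^+ (n - j)) =
    \sum_(j < n) k * (tau A (Z ^+ j.+1) * tau A (Z ^+ (n - j + m))).
  rewrite mulr_sumr linear_sum; apply: eq_bigr => j _ /=.
  by rewrite -scalerAr tauZ -exprD mulrA addnC.
rewrite dS !mulrBr !linearB /= e1 mulrA -exprSr IHn [in RHS]big_ord_recl /= subn0.
rewrite -scalerAr tauZ -exprD [(m + n.+1)%N]addnC.
set s1 := \sum_(l < n) _; set s2 := \sum_(j < n) _; set s3 := \sum_(i < n) _.
have -> : s3 = s1.
  apply: eq_bigr => l _; congr (_ * tau A (Z ^+ _) + _); first by lia.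
  have -> : (n - bump 0 l = n.-1 - l)%N by rewrite /bump; lia.
  apply: eq_bigr => j _; congr (_ * (_ * tau A (Z ^+ _))).
  by have := ltn_ord j; lia.
by ring.
Qed.

Lemma probe_power (Z : A) (p : A -> A) (s : nat -> state) :
  s 0%N = vacuum -> (forall l, value (s l) = Z ^+ l) ->
  (forall l y, probe (s l.+1) y = p y * Z ^+ l + probe (s l) (y * Z)) ->
  forall l y, probe (s l) y = \sum_(j < l) p (y * Z ^+ j) * Z ^+ (l.-1 - j).
Proof.
move=> s0 sv sp; elim=> [|l IHl] y; first by rewrite s0 big_ord0.
rewrite sp IHl big_ord_recl /= expr0 mulr1 subn0; congr (_ + _).
apply: eq_bigr => j _; rewrite -mulrA -exprS; congr (_ * Z ^+ _).
by rewrite /bump; have := ltn_ord j; lia.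
Qed.

Lemma drift_iter_u (u b : A) n : let T s := op_const b (op_u u s) in
  value (iter n T vacuum) = (b * u) ^+ n /\
  tau A (drift (iter n T vacuum)) = moment_rate 1 n (fun m => tau A ((b * u) ^+ m)).
Proof.
move=> T; set Z := b * u.
have sv l : value (iter l T vacuum) = Z ^+ l.
  by elim: l => //= l IHl; rewrite !stateE IHl mulrA exprS.
split => //; pose p y := ('i * tau A (y * b)) *: u.
have sp l y : probe (iter l.+1 T vacuum) y =
    p y * Z ^+ l + probe (iter l T vacuum) (y * Z).
  by rewrite /= !stateE sv -mulrA -scalerAl.
have dS l : drift (iter l.+1 T vacuum) = Z * drift (iter l T vacuum) -
    (1 / 2) *: Z ^+ l.+1 - \sum_(j < l) (1 * tau A (Z ^+ j.+1)) *: Z ^+ (l - j).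
  rewrite iterS /T !stateE -/T sv (probe_power Z p (fun l => iter l T vacuum)) //.
  rewrite !(mulrBr, mulrDr) mulrA -!scalerAr mulrA -exprS mul1r; congr (_ + _).
  rewrite mulr_sumr scaler_sumr -sumrN; apply: eq_bigr => j _.
  rewrite /p -scalerAl -scalerAr !scalerA mulrA -expr2 sqrCi mulN1r scaleNr mul1r.
  rewrite mulrA -exprS; congr (- (_ *: Z ^+ _)).
    by rewrite tau_tracial mulrA -/Z -exprS.
  by have := ltn_ord j; lia.
exact: (drift_power Z 1 (fun l => drift (iter l T vacuum)) erefl dS).
Qed.

Lemma drift_iter_ustar (u : A) n : let T := op_ustar u in
  value (iter n T vacuum) = star u ^+ n /\
  tau A (drift (iter n T vacuum)) = moment_rate 1 n (fun m => tau A (star u ^+ m)).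
Proof.
move=> T; set Z := star u.
have sv l : value (iter l T vacuum) = Z ^+ l.
  by elim: l => //= l IHl; rewrite !stateE IHl exprS.
split => //; pose p y : A := - ('i * tau A (y * Z))%:A.
have sp l y : probe (iter l.+1 T vacuum) y =
    p y * Z ^+ l + probe (iter l T vacuum) (y * Z).
  by rewrite /= !stateE sv addrC mulNr -scalerAl mul1r.
have dS l : drift (iter l.+1 T vacuum) = Z * drift (iter l T vacuum) -
    (1 / 2) *: Z ^+ l.+1 - \sum_(j < l) (1 * tau A (Z ^+ j.+1)) *: Z ^+ (l - j).
  rewrite iterS /T !stateE -/T sv (probe_power Z p (fun l => iter l T vacuum)) //.
  rewrite -exprS mul1r; congr (_ - _).
  rewrite mulr_sumr scaler_sumr; apply: eq_bigr => j _.
  rewrite /p mul1r -exprSr mulNr mulrN -scalerAl mul1r -scalerAr scalerN scalerA.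
  rewrite mulrA -expr2 sqrCi mulN1r scaleNr opprK mul1r -exprS; congr (_ *: Z ^+ _).
  by have := ltn_ord j; lia.
exact: (drift_power Z 1 (fun l => drift (iter l T vacuum)) erefl dS).
Qed.

(** Since r z r = z^* for z = r t, the word r z^n is conjugate to its middle letter,
    which is r or t. *)
Lemma tau_odd_word (r t : A) n : r * r = 1 -> t * t = 1 ->
  tau A r = 0 -> tau A t = 0 -> tau A (r * (r * t) ^+ n) = 0.
Proof.
move=> rr tt r0 t0.
have ZZ : (r * t) * (t * r) = 1 by rewrite mulrA -(mulrA r) tt mulr1 rr.
have ZX m : (r * t) ^+ m * (t * r) ^+ m = 1.
  elim: m => [|m IHm]; first by rewrite !expr0 mulr1.
  by rewrite exprSr exprS mulrA -(mulrA _ (r * t)) ZZ mulr1.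
have rZ m : r * (r * t) ^+ m = (t * r) ^+ m * r.
  elim: m => [|m IHm]; first by rewrite !expr0 mulr1 mul1r.
  by rewrite !exprSr !mulrA IHm -(mulrA _ r r) rr mulr1 -(mulrA _ r r) rr mulr1.
have [m [->|->]] : exists m, n = m.*2 \/ n = m.*2.+1.
  by exists n./2; rewrite -{1 3}(odd_double_half n); case: (odd n); [right|left].
  by rewrite -addnn exprD mulrA rZ tau_tracial mulrA ZX mul1r.
rewrite -addnn -addnS exprD exprS mulrA rZ -[r * t * _]mulrA mulrA -[_ * r * r]mulrA rr mulr1.
by rewrite tau_tracial -mulrA ZX mulr1.
Qed.

(** The word (r u t u^* )^n runs at double speed: contractions of a u with a u^*
    leave odd words in the symmetries r and u t u^*, of trace 0, while those of u
    with u and of u^* with u^* contribute equally. *)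
Lemma drift_iter_conj (u r t : A) n : unitary u -> r * r = 1 -> t * t = 1 ->
  tau A r = 0 -> tau A t = 0 ->
  let T s := op_const r (op_u u (op_const t (op_ustar u s))) in
  let Z := r * u * t * star u in
  value (iter n T vacuum) = Z ^+ n /\
  tau A (drift (iter n T vacuum)) = moment_rate 2 n (fun m => tau A (Z ^+ m)).
Proof.
move=> [u1 u2] rr tt r0 t0 T Z; pose t' := u * t * star u.
have ZE : Z = r * t' by rewrite /t' !mulrA.
have t't' : t' * t' = 1.
  by rewrite /t' !mulrA -(mulrA _ (star u)) u1 mulr1 -(mulrA u) tt mulr1.
have t'0 : tau A t' = 0 by rewrite /t' tau_tracial mulrA u1 mul1r.
have odd m : tau A (r * Z ^+ m) = 0 by rewrite ZE; exact: tau_odd_word.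
have rZ : r * Z = t' by rewrite ZE mulrA rr mul1r.
have sv l : value (iter l T vacuum) = Z ^+ l.
  by elim: l => //= l IHl; rewrite !stateE IHl !mulrA exprS.
split => //; pose p y := ('i * tau A (y * r)) *: t' - ('i * tau A (y * Z))%:A.
have sp l y : probe (iter l.+1 T vacuum) y =
    p y * Z ^+ l + probe (iter l T vacuum) (y * Z).
  rewrite /= !stateE sv mulrBl -!scalerAl mul1r /t' /Z !mulrA.
  by rewrite -addrA; congr (_ + _); rewrite addrC.
have dS l : drift (iter l.+1 T vacuum) = Z * drift (iter l T vacuum) -
    (2 / 2) *: Z ^+ l.+1 - \sum_(j < l) (2 * tau A (Z ^+ j.+1)) *: Z ^+ (l - j).
  have -> : drift (iter l.+1 T vacuum) = Z * drift (iter l T vacuum) - Z ^+ l.+1 +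
      ('i *: (r * probe (iter l T vacuum) t') - 'i *: (Z * probe (iter l T vacuum) 1)).
    rewrite iterS /T !stateE -/T sv.
    rewrite -/t' t'0 mulr0 scale0r subr0 !(mulrDr, mulrN) -!scalerAr.
    rewrite !mulrA -/Z.
    by rewrite -exprS (AC 5 (1*(2*4)*(5*3))) /= -opprD half_half.
  rewrite !(probe_power Z p (fun l => iter l T vacuum)) // divff ?scale1r ?pnatr_eq0 //.
  congr (_ + _); rewrite !mulr_sumr !scaler_sumr -sumrB -sumrN.
  apply: eq_bigr => j _.
  have -> : p (t' * Z ^+ j) = ('i * tau A (Z ^+ j.+1)) *: t'.
    have e : t' * Z ^+ j.+1 = r * Z ^+ j.+2 by rewrite -{1}rZ -mulrA -exprS.
    rewrite /p -[t' * Z ^+ j * Z]mulrA -exprSr e odd.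
    by rewrite mulr0 scale0r subr0 [tau A (_ * r)]tau_tracial mulrA -ZE -exprS.
  have -> : p (1 * Z ^+ j) = - ('i * tau A (Z ^+ j.+1))%:A.
    by rewrite /p mul1r -exprSr tau_tracial odd mulr0 scale0r sub0r.
  rewrite mulNr mulrN scalerN opprK -!scalerAl mul1r -!scalerAr !scalerA.
  rewrite [r * _]mulrA -ZE -exprS mulrA -expr2 sqrCi mulN1r -scalerDl.
  have -> (z : R[i]) : - z - z = - (2 * z) by ring.
  rewrite scaleNr; congr (- (_ *: Z ^+ _)).
  by have := ltn_ord j; lia.
exact: (drift_power Z 2 (fun l => drift (iter l T vacuum)) erefl dS).
Qed.
End Words.

(** * Alternating centered words *)

Section Blocks.
Context {R : realType} {A : tracialWStarSpace R}.
Variables (BU BP : set A).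
Hypothesis freeUP : star_free BU BP.
Local Notation SU := (smallest star_subalgebra BU).
Local Notation SP := (smallest star_subalgebra BP).
Let sU : star_subalgebra SU. Proof. exact: smallest_star_subalgebra. Qed.
Let sP : star_subalgebra SP. Proof. exact: smallest_star_subalgebra. Qed.

Definition pair_prod (z : seq (A * A)) : A := \prod_(y <- z) (y.1 * y.2).

Fixpoint alternating (z : seq (A * A)) : Prop :=
  if z is y :: z' then
    [/\ centered_in SP y.1, centered_in SU y.2 & alternating z']
  else True.

Lemma alternating_cat z z' :
  alternating (z ++ z') <-> alternating z /\ alternating z'.
Proof.
elim: z => [|y z IHz] /=; first by split=> // -[].
split=> [[? ? /IHz[]] //|[[? ? ?] ?]]; split => //; exact/IHz.
Qed.

Lemma pair_prod_cat z z' : pair_prod (z ++ z') = pair_prod z * pair_prod z'.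
Proof. by rewrite /pair_prod big_cat. Qed.

Lemma pair_prod_cons y z : pair_prod (y :: z) = y.1 * y.2 * pair_prod z.
Proof. by rewrite /pair_prod big_cons. Qed.

(** The outer constants e and b are adjacent under the trace; splitting e b into a
    centered part and a scalar leaves two alternating centered words. *)
Lemma tau_alternating b a z e : SP b -> centered_in SU a -> alternating z ->
  SP e -> tau A (b * a * pair_prod z * e) = 0.
Proof.
move=> Pb ca alt Pe.
pose fl := flatten [seq [:: (false, y.1); (true, y.2)] | y : A * A <- z].
have prod_fl : \prod_(y <- fl) y.2 = pair_prod z.
  rewrite /fl /pair_prod; elim: (z) => [|y z' IHz] /=; first by rewrite !big_nil.
  by rewrite !big_cons IHz /= mulrA.
have cent_fl y : y \in fl -> centered_in
    (smallest star_subalgebra (if y.1 then BU else BP)) y.2.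
  rewrite /fl; elim: (z) alt => [|y' z' IHz] //= [c1 c2 alt].
  by rewrite !inE => /or3P[/eqP->|/eqP->|/(IHz alt)].
have path_fl a' : path (fun x y : bool * A => x.1 != y.1) (true, a') fl.
  by rewrite /fl; elim: (z) a' => //= y z' IHz a'; exact: IHz.
have z1 : tau A (a * pair_prod z) = 0.
  have := free_seq _ _ freeUP ((true, a) :: fl) isT.
  rewrite big_cons prod_fl; apply; last exact: path_fl.
  move=> y; by rewrite inE => /orP[/eqP->|/cent_fl].
have z2 c : centered_in SP c -> tau A (c * a * pair_prod z) = 0.
  move=> cc; have := free_seq _ _ freeUP ((false, c) :: (true, a) :: fl) isT.
  rewrite !big_cons prod_fl mulrA; apply; last exact: path_fl.
  move=> y; by rewrite !inE => /or3P[/eqP->|/eqP->|/cent_fl].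
rewrite tau_tracial !mulrA; set c := e * b.
have Pc : SP c by exact: (ssubM _ sP).
have cc := centered_sub _ _ sP Pc; have cE : c = (c - (tau A c)%:A) + (tau A c)%:A.
  by rewrite subrK.
clearbody c; move: (c - _) cc cE => c' cc ->.
by rewrite !mulrDl linearD /= z2 // add0r -!scalerAl mul1r tauZ z1 mulr0.
Qed.

Lemma tau_alternating_open g z b : SU g -> alternating z -> centered_in SP b ->
  tau A (g * pair_prod z * b) = 0.
Proof.
move=> Ug alt [Pb b0].
rewrite -mulrA tau_tracial -(subrK (tau A g)%:A g) mulrDr linearD /=.
have cg := centered_sub _ _ sU Ug.
have -> : tau A (pair_prod z * b * (g - (tau A g)%:A)) = 0.
  case: z alt => [_|[b1 a1] z [[Pb1 _] ca alt]] /=.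
    rewrite /pair_prod big_nil mul1r.
    have := tau_alternating b _ [::] 1 Pb cg I (ssub1 _ sP).
    by rewrite /pair_prod big_nil !mulr1.
  rewrite pair_prod_cons /=.
  have := tau_alternating b1 a1 (z ++ [:: (b, g - (tau A g)%:A)]) 1 Pb1 ca _ (ssub1 _ sP).
  rewrite pair_prod_cat pair_prod_cons /pair_prod big_nil !mulr1 !mulrA; apply.
  by apply/alternating_cat; split => //=; split => //; split.
rewrite add0r -scalerAr mulr1 tauZ.
case: z alt => [_|[b1 a1] z [[Pb1 _] ca alt]] /=.
  by rewrite /pair_prod big_nil mul1r b0 mulr0.
by rewrite pair_prod_cons tau_alternating ?mulr0.
Qed.

(** A block (b, w, c) stands for b w(u) when c is false and for b (w(u) - tau w(u))
    when c is true. *)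
Definition block : Type := (A * seq bool * bool)%type.

Section FixedTime.
Variable u : A.
Hypothesis Uu : SU u.

Definition word_trace w := tau A (word_value u w).
Definition word_trace_rate w := tau A (word_drift u w).

(** A word minus its trace; the trace moves with u, which contributes the last
    term of the drift. *)
Definition op_centered w (s : state) : @state R A :=
  ((word_value u w - (word_trace w)%:A) * value s,
   fun y => probe (op_word u w s) y - word_trace w *: probe s y,
   drift (op_word u w s) - word_trace w *: drift s - word_trace_rate w *: value s).

Definition op_block (x : block) (s : state) : @state R A :=
  op_const x.1.1 (if x.2 then op_centered x.1.2 s else op_word u x.1.2 s).

Definition op_blocks (p : seq block) (s : @state R A) := foldr op_block s p : @state R A.
Definition block_state (x : seq block) (e : A) : @state R A :=
  op_blocks x (op_const e vacuum).

Definition block_value (x : block) : A :=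
  x.1.1 * (if x.2 then word_value u x.1.2 - (word_trace x.1.2)%:A
           else word_value u x.1.2).
Definition blocks_value (p : seq block) : A := \prod_(x <- p) block_value x.

Lemma value_centered w s : value (op_centered w s) =
  (word_value u w - (word_trace w)%:A) * value s.
Proof. by []. Qed.
Lemma probe_centered w s y : probe (op_centered w s) y =
  probe (op_word u w s) y - word_trace w *: probe s y.
Proof. by []. Qed.
Lemma drift_centered w s : drift (op_centered w s) =
  drift (op_word u w s) - word_trace w *: drift s - word_trace_rate w *: value s.
Proof. by []. Qed.
Definition centeredE := (value_centered, probe_centered, drift_centered).

Lemma split_block k x s s1 s2 a : state_split k s s1 s2 a ->
  state_split k (op_block x s) (op_block x s1) (op_block x s2) (block_value x * a).
Proof.
move=> sp; case: x => [[b w] c]; rewrite /op_block /block_value /= -mulrA.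
apply: split_const; case: c; last exact: split_word.
have [ev ep ed] := sp; have [fv fp fd] := split_word u k w s s1 s2 a sp.
split=> [|y|]; rewrite !centeredE ?fp ?fd ?ev ?ep ?ed.
- by rewrite mulrDr scalerAr.
- rewrite scalerBr scalerDr !scalerA [k * _]mulrC opprD.
  by rewrite addrACA.
- rewrite [(_ - _) * a]mulrBl -scalerAl mul1r !scalerDr !scalerN !scalerA !opprD.
  rewrite [k * word_trace w]mulrC [k * word_trace_rate w]mulrC.
  by rewrite (AC (3*3*2) ((1*4*7)*(2*5*8)*(3*6))).
Qed.

Lemma split_blocks k p s s1 s2 a : state_split k s s1 s2 a ->
  state_split k (op_blocks p s) (op_blocks p s1) (op_blocks p s2)
    (blocks_value p * a).
Proof.
rewrite /blocks_value => sp; elim: p => [|x p IHp] /=.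
  by rewrite big_nil mul1r.
by rewrite big_cons -mulrA; exact: split_block.
Qed.

Lemma value_op_block x s : value (op_block x s) = block_value x * value s.
Proof.
case: x => [[b w] []]; rewrite /op_block /block_value value_const -mulrA //=.
by rewrite value_op_word.
Qed.

Lemma value_op_blocks p s : value (op_blocks p s) = blocks_value p * value s.
Proof.
rewrite /blocks_value; elim: p => [|x p IHp] /=; first by rewrite big_nil mul1r.
by rewrite value_op_block IHp big_cons mulrA.
Qed.

(** Centering the word of one block: the difference is the word in which the block
    is reduced to its constant. *)
Lemma split_center b w s : state_split (word_trace w)
  (op_block (b, w, false) s) (op_block (b, w, true) s) (op_const b s)
  (b * (word_trace_rate w *: value s)).
Proof.
apply: (split_const _ b (op_word u w s) (op_centered w s) s).
split=> [|y|]; rewrite !centeredE ?value_op_word.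
- by rewrite mulrBl -scalerAl mul1r subrK.
- by rewrite subrK.
- by rewrite addrAC !subrK.
Qed.

Lemma word_value_mem w : SU (word_value u w).
Proof.
elim: w => [|c w IHw] /=; first exact: (ssub1 _ sU).
by apply: (ssubM _ sU) => //; case: c => //; exact: (ssub_star _ sU).
Qed.

Lemma word_probe_mem w y : SU (word_probe u w y).
Proof.
have Us := ssub_star _ sU _ Uu; rewrite /word_probe.
elim: w y => [|c w IHw] y /=.
  exact: (ssub0 _ sU).
have Uw := word_value_mem w.
case: c; rewrite !stateE value_op_word mulr1.
  apply: (ssubD _ sU) => //; apply: (ssubZ _ sU); exact: (ssubM _ sU).
by apply: (ssubB _ sU) => //; exact: (ssubZ _ sU).
Qed.

Lemma word_drift_mem w : SU (word_drift u w).
Proof.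
have Us := ssub_star _ sU _ Uu; rewrite /word_drift.
elim: w => [|c w IHw] /=.
  exact: (ssub0 _ sU).
have Uw := word_value_mem w; have Up := word_probe_mem w.
case: c; rewrite !stateE value_op_word mulr1.
  apply: (ssubD _ sU); last by apply: (ssubZ _ sU); exact: Up.
  by apply: (ssubB _ sU); last apply: (ssubZ _ sU); exact: (ssubM _ sU).
apply: (ssubB _ sU).
  2: by apply: (ssubZ _ sU); apply: (ssubM _ sU) => //; exact: Up.
by apply: (ssubB _ sU); last apply: (ssubZ _ sU); exact: (ssubM _ sU).
Qed.

Lemma word_probe_eq0 w y : (forall g, SU g -> tau A (y * g) = 0) ->
  word_probe u w y = 0.
Proof.
have Us := ssub_star _ sU _ Uu; rewrite /word_probe.
elim: w y => [|c w IHw] y y0 //=.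
case: c; rewrite !stateE IHw ?(add0r, sub0r).
- have -> : tau A y = 0 by rewrite -[y]mulr1; apply: y0; exact: (ssub1 _ sU).
  by rewrite mulr0 scale0r ?addr0.
- by move=> g Ug; rewrite -mulrA y0 //; exact: (ssubM _ sU _ _ Uu Ug).
- by rewrite y0 // mulr0 scale0r oppr0.
- by move=> g Ug; rewrite -mulrA y0 //; exact: (ssubM _ sU _ _ Us Ug).
Qed.

Lemma drift_op_word w s : (forall g, SU g -> probe s g = 0) ->
  drift (op_word u w s) = word_drift u w * value s + word_value u w * drift s.
Proof.
move=> s0; have Us := ssub_star _ sU _ Uu; rewrite /word_drift.
elim: w => [|c w IHw] /=; first by rewrite mul0r add0r mul1r.
have Uw := word_value_mem w.
case: c; rewrite !stateE IHw probe_op_word value_op_word s0 ?addr0.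
- rewrite -/(word_probe u w) value_op_word mulr1 !mulrDl mulNr -!scalerAl.
  by rewrite mulrDr !mulrA (AC (2*1*1) ((1*3*4)*2)).
- exact: (ssubM _ sU).
- rewrite -/(word_probe u w) value_op_word mulr1 !mulrDl !mulNr -!scalerAl.
  by rewrite mulrDr !mulrA (AC (2*1*1) ((1*3*4)*2)).
- by rewrite mul1r.
Qed.

Definition linear_probe (s : @state R A) := forall (k : R[i]) (y y' : A),
  probe s (k *: y + y') = k *: probe s y + probe s y'.

Lemma linear_probe_letter c s : linear_probe s -> linear_probe (op_letter u c s).
Proof.
move=> ls k y y'; have tauP z z' : tau A (k *: z + z') = k * tau A z + tau A z'.
  by rewrite linearD /= tauZ.
case: c; rewrite !stateE mulrDl -scalerAl ls ?tauP.
  rewrite scalerDr scalerA mulrDr scalerDl mulrCA.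
  by rewrite addrACA.
rewrite scalerBr scalerA mulrDr scalerDl mulrCA opprD.
by rewrite addrACA.
Qed.

Lemma linear_probe_word w s : linear_probe s -> linear_probe (op_word u w s).
Proof. by move=> ls; elim: w => //= c w IHw; exact: linear_probe_letter. Qed.

Lemma linear_probe_blocks p s : linear_probe s -> linear_probe (op_blocks p s).
Proof.
move=> ls; elim: p => //= [[[b w] c] p IHp].
set s1 := op_blocks p s in IHp *.
have lw := linear_probe_word w _ IHp.
move=> k y y'; rewrite /op_block /= !stateE mulrDl -scalerAl.
case: c => //=; rewrite !centeredE lw IHp.
rewrite scalerDr scalerBr !scalerA [k * _]mulrC opprD.
by rewrite addrACA.
Qed.

Fixpoint consts_in (P : A -> Prop) (x : seq block) : Prop :=
  if x is y :: x' then P y.1.1 /\ consts_in P x' else True.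

Lemma consts_in_cat P x x' :
  consts_in P (x ++ x') <-> consts_in P x /\ consts_in P x'.
Proof.
elim: x => [|y x IHx] /=; first by split=> // -[].
by rewrite IHx; tauto.
Qed.

Definition word_centered w : A := word_value u w - (word_trace w)%:A.

Lemma word_centered_in w : centered_in SU (word_centered w).
Proof. exact: (centered_sub _ _ sU (word_value_mem w)). Qed.

(** The word between a cut inside a block and a cut further left is an alternating
    product, closed by the constant of the block: its trace vanishes. *)
Lemma probe_centered_blocks x e p g : all snd x -> consts_in (centered_in SP) x ->
  alternating p -> SU g -> probe (block_state x e) (g * pair_prod p) = 0.
Proof.
elim: x p => [|[[b w] c] x IHx] p //= /andP[-> allx] [cb cx] altp Ug.
rewrite -/(block_state x e) in IHx *; set s := block_state x e in IHx *.
have ls : linear_probe s by apply: linear_probe_blocks => k y y'; rewrite /probe /= scaler0 addr0.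
rewrite /op_block /= !stateE centeredE probe_op_word.
set y := g * pair_prod p * b.
have -> : word_probe u w y = 0.
  apply: word_probe_eq0 => h Uh; rewrite tau_tracial /y !mulrA.
  by apply: tau_alternating_open => //; exact: (ssubM _ sU).
rewrite mul0r add0r.
have -> : y * word_value u w =
    word_trace w *: y + y * (word_value u w - (word_trace w)%:A).
  by rewrite mulrBr -scalerAr mulr1 addrC subrK.
rewrite ls addrAC subrr add0r.
have -> : y * (word_value u w - (word_trace w)%:A) =
    g * pair_prod (p ++ [:: (b, word_centered w)]).
  by rewrite pair_prod_cat pair_prod_cons /pair_prod big_nil mulr1 !mulrA.
apply: IHx => //; apply/alternating_cat; split => //=; split => //.
exact: word_centered_in.
Qed.

Definition block_pairs (x : seq block) := [seq (y.1.1, word_centered y.1.2) | y <- x].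

Lemma alternating_blocks x : consts_in (centered_in SP) x -> alternating (block_pairs x).
Proof.
elim: x => //= y x IHx [cy cx]; split => //; first exact: word_centered_in.
exact: IHx.
Qed.

Lemma value_centered_blocks x e : all snd x ->
  value (block_state x e) = pair_prod (block_pairs x) * e.
Proof.
rewrite value_op_blocks /= value_const mulr1 => allx; congr (_ * _).
rewrite /blocks_value; elim: x allx => [|[[b w] c] x IHx] /=.
  by rewrite /pair_prod !big_nil.
by move=> /andP[/= -> /IHx IH]; rewrite pair_prod_cons big_cons IH.
Qed.

Lemma tau_value_centered (y : block) x e : y.2 -> all snd x -> SP y.1.1 ->
  consts_in (centered_in SP) x -> SP e -> tau A (value (block_state (y :: x) e)) = 0.
Proof.
move=> y2 x2 Py cx Pe; rewrite value_centered_blocks /= ?y2 // pair_prod_cons.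
by apply: tau_alternating => //; [exact: word_centered_in|exact: alternating_blocks].
Qed.

(** Contractions between different blocks vanish by [probe_centered_blocks]. The
    other terms of the drift replace one centered word by its own drift minus the
    rate of its trace, which is centered: alternating centered words again. *)
Lemma tau_drift_centered (y : block) x e : y.2 -> all snd x -> SP y.1.1 ->
  consts_in (centered_in SP) x -> SP e -> tau A (drift (block_state (y :: x) e)) = 0.
Proof.
move=> y2 x2 Py cx Pe.
have step b w s : (forall g, SU g -> probe s g = 0) ->
    drift (op_block (b, w, true) s) =
    b * (word_drift u w - (word_trace_rate w)%:A) * value s +
    b * word_centered w * drift s.
  move=> s0; change (drift (op_const b (op_centered w s)) =
      b * (word_drift u w - (word_trace_rate w)%:A) * value s +
      b * word_centered w * drift s).
  rewrite drift_const drift_centered drift_op_word //.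
  rewrite /word_centered -!mulrA -mulrDr; congr (_ * _).
  by rewrite !mulrBl -!scalerAl !mul1r (AC (2*1*1) ((1*4)*(2*3))).
have dcent w : centered_in SU (word_drift u w - (word_trace_rate w)%:A).
  exact: (centered_sub _ _ sU (word_drift_mem w)).
have p0 z : consts_in (centered_in SP) z -> all snd z ->
    forall g, SU g -> probe (block_state z e) g = 0.
  move=> cz z2 g Ug; rewrite -[g]mulr1 (_ : 1 = pair_prod [::]).
    exact: probe_centered_blocks.
  by rewrite /pair_prod big_nil.
suff main z b a p : SP b -> centered_in SU a -> alternating p ->
    all snd z -> consts_in (centered_in SP) z ->
    tau A (b * a * pair_prod p * drift (block_state z e)) = 0.
  case: y y2 Py => [[b w] c] y2 Pb; rewrite /= in y2 Pb; rewrite {}y2.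
  rewrite (step b w (block_state x e) (p0 _ cx x2)).
  have := main x b _ [::] Pb (word_centered_in w) I x2 cx.
  rewrite /pair_prod big_nil mulr1 linearD /= => ->.
  rewrite addr0 value_centered_blocks // mulrA.
  by apply: tau_alternating => //; exact: alternating_blocks.
elim: z b a p => [|[[b' w] c] z IHz] b a p Pb ca altp.
  by rewrite /= /drift /= !mulr0 linear0.
move=> /andP[c1 z2] [cb' cz]; rewrite /= in c1 cb'; rewrite {}c1.
rewrite (step b' w (block_state z e) (p0 _ cz z2)).
rewrite mulrDr linearD /= value_centered_blocks // !mulrA.
have -> : b * a * pair_prod p * b' * word_centered w =
    b * a * pair_prod (p ++ [:: (b', word_centered w)]).
  by rewrite pair_prod_cat pair_prod_cons /pair_prod big_nil mulr1 !mulrA.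
rewrite IHz //; last first.
  by apply/alternating_cat; split => //=; split => //; exact: word_centered_in.
rewrite addr0.
have := tau_alternating b a (p ++ (b', word_drift u w - (word_trace_rate w)%:A)
  :: block_pairs z) e Pb ca.
rewrite pair_prod_cat pair_prod_cons !mulrA; apply => //.
apply/alternating_cat; split => //=; split => //; exact: alternating_blocks.
Qed.

End FixedTime.
End Blocks.

(** * The drift of a word is the rate of change of its trace *)

Section BlockRates.
Context {R : realType} {A : tracialWStarSpace R}.
Variables (U : R -> A) (BP : set A).
Implicit Types (u b e : A) (x p q : seq (@block R A)).
Local Notation BU := [set U t | t in [set t : R | 0 <= t]].
Hypothesis freeUP : star_free BU BP.
Hypothesis unitU : forall t, 0 <= t -> unitary (U t).
Hypothesis rateU : forall n, rate (fun s => tau A (U s ^+ n))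
  (fun s => moment_rate 1 n (fun k => tau A (U s ^+ k))).
Local Notation SP := (smallest star_subalgebra BP).
Let sP : star_subalgebra SP. Proof. exact: smallest_star_subalgebra. Qed.

Let memU t : 0 <= t -> smallest star_subalgebra BU (U t).
Proof. by move=> t0; apply: mem_smallest_star; exists t. Qed.

Lemma op_word_nseq (u : A) n c s : op_word u (nseq n c) s = iter n (op_letter u c) s.
Proof. by elim: n => //= n ->. Qed.

(** A word in U s alone is a power of U s or of its adjoint. *)
Lemma rate_word w : rate (fun s => word_trace (U s) w)
  (fun s => word_trace_rate (U s) w).
Proof.
have [n [c red]] := op_word_reduced (A := A) w.
have trace s : 0 <= s ->
    word_trace (U s) w = tau A ((if c then U s else star (U s)) ^+ n).
  move=> s0; rewrite /word_trace -word_value_nseq.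
  have := value_op_word (U s) w vacuum; have := value_op_word (U s) (nseq n c) vacuum.
  by rewrite /= !mulr1 -red; [move=> <- <-|exact: unitU].
have drft s : 0 <= s -> word_trace_rate (U s) w =
    moment_rate 1 n (fun k => tau A ((if c then U s else star (U s)) ^+ k)).
  move=> s0; rewrite /word_trace_rate /word_drift red; last exact: unitU.
  rewrite op_word_nseq; case: c {red trace}.
    have [_] := drift_iter_u (U s) 1 n; rewrite mul1r => <-.
    congr (tau A (drift _)); apply: eq_iter => s'; by rewrite op_const1.
  by have [_ <-] := drift_iter_ustar (U s) n.
have base : rate (fun s => tau A ((if c then U s else star (U s)) ^+ n))
    (fun s => moment_rate 1 n (fun k => tau A ((if c then U s else star (U s)) ^+ k))).
  case: c {red trace drft} => //.
  apply: eq_rate (rate_conj _ _ (rateU n)) => s s0.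
    by rewrite -tau_star starX.
  rewrite -[1]/((1 : R)%:C) moment_rate_conj; congr (moment_rate _ _ _).
  by apply/funext => k; rewrite -tau_star starX.
by apply: eq_rate base => s s0; rewrite ?trace ?drft.
Qed.

Definition block_rates (x : seq block) (e : A) :=
  rate (fun s => tau A (value (block_state (U s) x e)))
       (fun s => tau A (drift (block_state (U s) x e))).

Definition absorb (b : A) (q : seq (@block R A)) (e : A) : seq (@block R A) * A :=
  if q is (b', w, c) :: q' then ((b * b', w, c) :: q', e) else ([::], b * e).

Lemma absorbE u b q e : op_const b (block_state u q e) =
  block_state u (absorb b q e).1 (absorb b q e).2.
Proof. by case: q => [|[[b' w] c] q] /=; rewrite ?op_constM. Qed.

Lemma size_absorb b q e : size (absorb b q e).1 = size q.
Proof. by case: q => [|[[b' w] c] q]. Qed.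

Lemma consts_absorb b q e : SP b -> consts_in SP q -> SP e ->
  consts_in SP (absorb b q e).1 /\ SP (absorb b q e).2.
Proof.
case: q => [|[[b' w] c] q] /=; first by move=> Pb _ Pe; split=> //; exact: (ssubM _ sP).
by move=> Pb [Pb' cq] Pe; do !split=> //; exact: (ssubM _ sP).
Qed.

Lemma block_state_cat u p q e :
  block_state u (p ++ q) e = op_blocks u p (block_state u q e).
Proof. by rewrite /block_state /op_blocks foldr_cat. Qed.

Section Step.
Variable n : nat.
Hypothesis IHn : forall x e, size x = n -> consts_in SP x -> SP e -> block_rates x e.

(** Centering one word, or undoing it, changes the trace by a multiple of the trace
    of a word with one block less. *)
Lemma rates_flip p b w q e c : (size p + size q)%N = n ->
  consts_in SP p -> SP b -> consts_in SP q -> SP e ->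
  block_rates (p ++ (b, w, c) :: q) e -> block_rates (p ++ (b, w, ~~ c) :: q) e.
Proof.
move=> szn cp Pb cq Pe rc.
have [cq' Pe'] := consts_absorb b q e Pb cq Pe.
set q' := (absorb b q e).1 in cq'; set e' := (absorb b q e).2 in Pe'.
have rpq : block_rates (p ++ q') e'.
  by apply: IHn => //; [rewrite size_cat size_absorb|exact/consts_in_cat].
have sp u : state_split (word_trace u w) (block_state u (p ++ (b, w, false) :: q) e)
    (block_state u (p ++ (b, w, true) :: q) e) (block_state u (p ++ q') e')
    (blocks_value u p * (b * (word_trace_rate u w *: value (block_state u q e)))).
  rewrite !block_state_cat /q' /e' -absorbE; apply: split_blocks; exact: split_center.
have vE u : tau A (value (block_state u (p ++ (b, w, false) :: q) e)) =
    tau A (value (block_state u (p ++ (b, w, true) :: q) e)) +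
    word_trace u w * tau A (value (block_state u (p ++ q') e')).
  by have [-> _ _] := sp u; rewrite linearD /= tauZ.
have dE u : tau A (drift (block_state u (p ++ (b, w, false) :: q) e)) =
    tau A (drift (block_state u (p ++ (b, w, true) :: q) e)) +
    (word_trace_rate u w * tau A (value (block_state u (p ++ q') e')) +
     word_trace u w * tau A (drift (block_state u (p ++ q') e'))).
  have [_ _ ->] := sp u; rewrite !linearD /= tauZ -!scalerAr tauZ.
  rewrite [block_state u (p ++ q') _]block_state_cat /q' /e' -absorbE.
  by rewrite [value (op_blocks _ _ (op_const _ _))]value_op_blocks value_const; ring.
have rm := rateM _ _ _ _ (rate_word w) rpq.
case: c rc => /= rc.
  by apply: eq_rate (rateD _ _ _ _ rc rm) => s s0; rewrite ?vE ?dE.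
by apply: eq_rate (rateB _ _ _ _ rc rm) => s s0; rewrite ?vE ?dE addrK.
Qed.

Let negb_neq (c c' : bool) : c != c' -> c' = ~~ c. Proof. by case: c c' => [] []. Qed.

Definition set_flag c (y : @block R A) : @block R A := (y.1, c).

Lemma rates_set_flags p q e c : (size p + size q)%N = n.+1 ->
  consts_in SP p -> consts_in SP q -> SP e ->
  block_rates (p ++ map (set_flag c) q) e -> block_rates (p ++ q) e.
Proof.
elim: q p => [|[[b w] c'] q IHq] p //= szn cp [Pb cq] Pe rc.
have szn' : (size p + size q)%N = n by move: szn; rewrite addnS => -[].
have rq : block_rates (p ++ (b, w, c) :: q) e.
  rewrite -cat_rcons; apply: IHq => //; last by rewrite cat_rcons.
    by rewrite size_rcons addSn szn'.
  by rewrite -cats1; apply/consts_in_cat.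
case: (eqVneq c c') => [<- //|neq].
rewrite (negb_neq _ _ neq).
exact: rates_flip.
Qed.

Lemma rates_set_flags' p q e c : (size p + size q)%N = n.+1 ->
  consts_in SP p -> consts_in SP q -> SP e ->
  block_rates (p ++ q) e -> block_rates (p ++ map (set_flag c) q) e.
Proof.
elim: q p => [|[[b w] c'] q IHq] p //= szn cp [Pb cq] Pe rc.
have szn' : (size p + size q)%N = n by move: szn; rewrite addnS => -[].
rewrite -cat_rcons; apply: IHq => //; rewrite ?cat_rcons.
- by rewrite size_rcons addSn szn'.
- by rewrite -cats1; apply/consts_in_cat.
case: (eqVneq c c') => [-> //|neq].
rewrite eq_sym in neq; rewrite /set_flag (negb_neq _ _ neq).
exact: rates_flip.
Qed.

Definition center (y : @block R A) : @block R A :=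
  (y.1.1 - (tau A y.1.1)%:A, y.1.2, y.2).

(** Replacing b by its centered version subtracts tau b times the word in which the
    two neighbours of b are concatenated: one block less. The first constant has
    no left neighbour and is left alone. *)
Lemma rates_center b0 w0 p q e : (size p + size q)%N = n ->
  consts_in SP p -> SP b0 -> consts_in SP q -> SP e ->
  block_rates (rcons p (b0, w0, false) ++ map (set_flag false \o center) q) e ->
  block_rates (rcons p (b0, w0, false) ++ map (set_flag false) q) e.
Proof.
elim: q p b0 w0 => [|[[b w] c] q IHq] p b0 w0 //= szn cp Pb0 [Pb cq] Pe rc.
have sz' : (size p + (size q).+1)%N = n by [].
set q1 := map (set_flag false) q.
have cq1 : consts_in SP q1.
  by rewrite /q1; elim: (q) cq => //= y z IH [? /IH].
have cent := centered_sub _ _ sP Pb.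
have r1 : block_rates (rcons p (b0, w0, false) ++ (b - (tau A b)%:A, w, false) :: q1) e.
  rewrite -cat_rcons; apply: IHq => //.
  - by rewrite size_rcons addSn -addnS.
  - by rewrite -cats1; apply/consts_in_cat.
  - by case: cent.
  by rewrite cat_rcons.
have r2 : block_rates (p ++ (b0, w0 ++ w, false) :: q1) e.
  apply: IHn => //; first by rewrite size_cat /= size_map.
  by apply/consts_in_cat.
have sp u : state_split (tau A b)
    (block_state u (rcons p (b0, w0, false) ++ (b, w, false) :: q1) e)
    (block_state u (rcons p (b0, w0, false) ++ (b - (tau A b)%:A, w, false) :: q1) e)
    (block_state u (p ++ (b0, w0 ++ w, false) :: q1) e) 0.
  rewrite !cat_rcons !block_state_cat -[0](mulr0 (blocks_value u p)).
  apply: split_blocks; set s1 := block_state u q1 e.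
  change (state_split (tau A b)
    (op_const b0 (op_word u w0 (op_const b (op_word u w s1))))
    (op_const b0 (op_word u w0 (op_const (b - (tau A b)%:A) (op_word u w s1))))
    (op_const b0 (op_word u (w0 ++ w) s1)) 0).
  rewrite /op_word foldr_cat -!/(op_word _ _ _) -[0](mulr0 b0) -[X in b0 * X](mulr0 (word_value u w0)).
  apply/split_const/split_word; set s2 := op_word u w s1.
  have l2 : linear_probe s2.
    apply: linear_probe_word; apply: linear_probe_blocks => k y y'.
    by rewrite /probe /= scaler0 addr0.
  split=> [|y|]; rewrite !stateE ?addr0.
  - by rewrite mulrBl -scalerAl mul1r subrK.
  - have -> : y * b = tau A b *: y + y * (b - (tau A b)%:A).
      by rewrite mulrBr -scalerAr mulr1 addrC subrK.
    by rewrite l2 addrC.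
  - by rewrite mulrBl -scalerAl mul1r subrK.
apply: eq_rate (rateD _ _ _ _ r1 (rateZ (tau A b) _ _ r2)) => s s0.
  by have [-> _ _] := sp (U s); rewrite linearD /= tauZ.
by have [_ _ ->] := sp (U s); rewrite addr0 linearD /= tauZ.
Qed.

Lemma rates_centered (y : @block R A) q e : y.2 -> SP y.1.1 -> all snd q ->
  consts_in (centered_in SP) q -> SP e -> block_rates (y :: q) e.
Proof.
move=> y2 Py q2 cq Pe; apply: eq_rate (rate_cst 0) => s s0.
  by rewrite (tau_value_centered _ _ freeUP) //; exact: memU.
by rewrite (tau_drift_centered _ _ freeUP) //; exact: memU.
Qed.

(** Up to words with fewer blocks, one may center all constants but the first, and
    then all words; both trace and drift are then identically 0. *)
Lemma rates_step x e : size x = n.+1 -> consts_in SP x -> SP e -> block_rates x e.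
Proof.
case: x => [|[[b w] c] q] // [szn] [Pb cq] Pe.
have cent : consts_in SP (map center q) /\ consts_in (centered_in SP) (map center q).
  elim: (q) cq => //= y z IH [Py /IH[? ?]].
  by have := centered_sub _ _ sP Py; case.
have [c1 c2] := cent.
apply: (rates_set_flags [::] _ e false) => //=; first by rewrite szn.
apply: (rates_center b w [::]) => //; rewrite /= map_comp.
apply: (rates_set_flags' [:: (b, w, false)] (map center q)) => //=.
  by rewrite size_map szn.
apply: (rates_set_flags [::] ((b, w, false) :: map center q) e true) => //=.
  by rewrite size_map szn.
apply: rates_centered => //.
  by rewrite all_map; apply/allP.
by elim: (q) c2 => //= y z IH [? /IH].
Qed.

End Step.

Lemma block_rate x e : consts_in SP x -> SP e -> block_rates x e.
Proof.
move En : (size x) => n; elim: n x e En => [|n IHn] x e; last exact: rates_step.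
move=> /size0nil -> _ _; apply: eq_rate (rate_cst (tau A e)) => s s0.
  by rewrite /= value_const mulr1.
by rewrite /drift /= mulr0 linear0.
Qed.

End BlockRates.

(** * The commutator of two projections *)

Section Final.
Context {R : realType} {A : tracialWStarSpace R}.
Implicit Types (u v w x y p : A).

Section Periodic.
Variables (U : R -> A) (BP : set A).
Hypothesis freeUP : star_free [set U t | t in [set t : R | 0 <= t]] BP.
Hypothesis unitU : forall t, 0 <= t -> unitary (U t).
Hypothesis rateU : forall n, rate (fun s => tau A (U s ^+ n))
  (fun s => moment_rate 1 n (fun k => tau A (U s ^+ k))).
Local Notation SP := (smallest star_subalgebra BP).

Lemma rate_mul (b : A) n : SP b -> rate (fun s => tau A ((b * U s) ^+ n))
  (fun s => moment_rate 1 n (fun k => tau A ((b * U s) ^+ k))).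
Proof.
move=> Pb.
have sE u : block_state u (nseq n (b, [:: true], false)) 1 =
    iter n (fun s => op_const b (op_u u s)) vacuum.
  by elim: n => [|m IHm] /=; [exact: op_const1|rewrite -IHm].
have cb : consts_in SP (nseq n (b, [:: true], false)) by elim: (n) => //= m; split.
have P1 : SP 1 by exact: (ssub1 _ (smallest_star_subalgebra _)).
apply: eq_rate (block_rate U BP freeUP unitU rateU _ 1 cb P1) => s s0;
  rewrite sE; have [h1 h2] := drift_iter_u (U s) b n.
  by rewrite h1.
by rewrite h2.
Qed.

Lemma rate_conj_mul (r q : A) n : SP r -> SP q -> r * r = 1 -> q * q = 1 ->
  tau A r = 0 -> tau A q = 0 ->
  rate (fun s => tau A ((r * U s * q * star (U s)) ^+ n))
  (fun s => moment_rate 2 n (fun k => tau A ((r * U s * q * star (U s)) ^+ k))).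
Proof.
move=> Pr Pq rr qq r0 q0.
pose x m : seq (@block R A) :=
  flatten (nseq m [:: (r, [:: true], false); (q, [:: false], false)]).
have sE u : block_state u (x n) 1 =
    iter n (fun s => op_const r (op_u u (op_const q (op_ustar u s)))) vacuum.
  by elim: n => [|m IHm] /=; [exact: op_const1|rewrite -IHm].
have cb : consts_in SP (x n) by elim: (n) => //= m; split.
have P1 : SP 1 by exact: (ssub1 _ (smallest_star_subalgebra _)).
apply: eq_rate (block_rate U BP freeUP unitU rateU _ 1 cb P1) => s s0;
  rewrite sE; have [h1 h2] := drift_iter_conj (U s) r q n (unitU s s0) rr qq r0 q0.
  by rewrite h1.
by rewrite h2.
Qed.

(** The first family at time s / 2 and the second at time s solve the same moment
    equations, with the same initial values. *)
Lemma moments_conj_mul (r q : A) n t : SP r -> SP q -> r * r = 1 -> q * q = 1 ->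
  tau A r = 0 -> tau A q = 0 -> U 0 = 1 -> 0 <= t ->
  tau A ((r * U t * q * star (U t)) ^+ n) = tau A ((r * q * U (2 * t)) ^+ n).
Proof.
move=> Pr Pq rr qq r0 q0 U0 t0.
pose f m (s : R) := tau A ((r * U (s / 2) * q * star (U (s / 2))) ^+ m).
pose g m (s : R) := tau A ((r * q * U s) ^+ m).
have Prq : SP (r * q) by exact: (ssubM _ (smallest_star_subalgebra _)).
have rf m : rate (f m) (fun s => moment_rate 1 m (f ^~ s)).
  have := rate_half _ _ (rate_conj_mul r q m Pr Pq rr qq r0 q0).
  apply: eq_rate => // s s0.
  by rewrite moment_rateZ mulVf ?pnatr_eq0.
have rg m : rate (g m) (fun s => moment_rate 1 m (g ^~ s)) by exact: rate_mul.
have := moment_rate_unique f g rf rg _ n (2 * t).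
rewrite /f /g [2 * t / 2]mulrAC divff ?pnatr_eq0 // mul1r; apply; last by rewrite mulr_ge0.
by move=> m; rewrite mul0r U0 star1 !mulr1.
Qed.
End Periodic.

(** For v = exp(i theta) this is 4 sin(theta)^2. *)
Definition sin_sqr v : A := 2 - v ^+ 2 - star v ^+ 2.

Lemma star_sin_sqr v : star (sin_sqr v) = sin_sqr v.
Proof. by rewrite /sin_sqr !starB !starX starK star_nat addrAC. Qed.

Lemma unitary_comm v : unitary v -> GRing.comm v (star v).
Proof. by case=> v1 v2; rewrite /GRing.comm v1 v2. Qed.

Lemma tau_unitary_powers v w : unitary v -> unitary w ->
  (forall n, tau A (v ^+ n) = tau A (w ^+ n)) ->
  forall a b, tau A (star v ^+ a * v ^+ b) = tau A (star w ^+ a * w ^+ b).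
Proof.
move=> [v1 _] [w1 _] vw; have red x m : star x * x = 1 -> star x ^+ m * x ^+ m = 1.
  move=> x1; elim: m => [|m IHm]; first by rewrite !expr0 mulr1.
  by rewrite exprSr exprS mulrA -(mulrA _ (star x)) x1 mulr1.
move=> a b; have [ab|/ltnW ba] := leqP a b.
  by rewrite -(subnKC ab) !exprD !mulrA !red // !mul1r vw.
rewrite -(subnK ba) !exprD -!mulrA !red // !mulr1 -!starX !tau_star.
by rewrite vw.
Qed.

(** The powers of [sin_sqr v] are Laurent polynomials in v. *)
Lemma tau_sin_sqr v w : unitary v -> unitary w ->
  (forall n, tau A (v ^+ n) = tau A (w ^+ n)) ->
  forall n, tau A (sin_sqr v ^+ n) = tau A (sin_sqr w ^+ n).
Proof.
move=> uv uw vw n.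
suff H a b : tau A (star v ^+ a * v ^+ b * sin_sqr v ^+ n) =
             tau A (star w ^+ a * w ^+ b * sin_sqr w ^+ n).
  by have := H 0%N 0%N; rewrite !expr0 !mul1r.
have step x a' b' m : unitary x ->
    tau A (star x ^+ a' * x ^+ b' * sin_sqr x ^+ m.+1) =
    2 * tau A (star x ^+ a' * x ^+ b' * sin_sqr x ^+ m)
    - tau A (star x ^+ a' * x ^+ b'.+2 * sin_sqr x ^+ m)
    - tau A (star x ^+ a'.+2 * x ^+ b' * sin_sqr x ^+ m).
  move=> ux; rewrite exprS {1}/sin_sqr mulrA !mulrBr !mulrBl !linearB /=.
  rewrite mulr_natr mulrnAl linearMn /= mulr_natl; congr (_ - _ - _).
    by rewrite -(mulrA _ (x ^+ b') (x ^+ 2)) -exprD addn2.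
  have cx : GRing.comm (x ^+ b') (star x ^+ 2).
    exact: commrX (commr_sym (commrX b' (commr_sym (unitary_comm _ ux)))).
  rewrite -(mulrA _ (x ^+ b') (star x ^+ 2)) cx.
  by rewrite mulrA -exprD addn2.
elim: n a b => [|m IHm] a b; first by rewrite !expr0 !mulr1; exact: tau_unitary_powers.
by rewrite !step // !IHm.
Qed.

Definition commutator x y : A := x * y - y * x.

Lemma commutatorZBl x y : commutator (2 * x - 1) y = 2 *: commutator x y.
Proof.
rewrite /commutator mulrBl mulrBr mul1r mulr1 opprB addrA subrK.
by rewrite mulr_natl mulrnAl mulrnAr -mulrnBl scaler_nat.
Qed.

Lemma commutatorZBr x y : commutator x (2 * y - 1) = 2 *: commutator x y.
Proof.
rewrite /commutator mulrBl mulrBr mul1r mulr1 opprB addrA subrK.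
by rewrite mulr_natl mulrnAl mulrnAr -mulrnBl scaler_nat.
Qed.

Lemma projection_symmetry p : orthogonal_projection p -> tau A p = 1 / 2 ->
  [/\ star (2 * p - 1) = 2 * p - 1, (2 * p - 1) * (2 * p - 1) = 1
    & tau A (2 * p - 1) = 0].
Proof.
move=> [sp pp] tp; split.
- by rewrite starB starM star_nat star1 sp mulr_natr mulr_natl.
- rewrite mulrBl mulrBr mulr1 mul1r !mulr_natl mulrnAl mulrnAr pp.
  by set y := p *+ 2; rewrite mulr2n addrK subKr.
by rewrite linearB /= tau1 mulr_natl linearMn /= tp; field.
Qed.

(** P and q = u Q u^* are affine in the symmetries 2 P - 1 and 2 q - 1, so their
    commutator is a quarter of that of the symmetries, which is V - V^* for the
    product V of the symmetries. *)
Lemma commutator_sqr (P Q u : A) : unitary u ->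
  orthogonal_projection P -> orthogonal_projection Q ->
  tau A P = 1 / 2 -> tau A Q = 1 / 2 ->
  ('i *: (P * u * Q * star u - u * Q * star u * P)) ^+ 2 =
  16^-1 *: sin_sqr ((2 * P - 1) * u * (2 * Q - 1) * star u).
Proof.
move=> [u1 u2] pP pQ tP tQ.
have [sr rr _] := projection_symmetry _ pP tP; have [sq qq _] := projection_symmetry _ pQ tQ.
have E : u * (2 * Q - 1) * star u = 2 * (u * Q * star u) - 1.
  by rewrite mulrBr mulrBl mulr1 u2 !mulr_natl mulrnAr mulrnAl.
set q := u * Q * star u in E *; set v := (2 * P - 1) * u * (2 * Q - 1) * star u.
have vE : v = (2 * P - 1) * (2 * q - 1) by rewrite -E !mulrA.
have ss : star (2 * q - 1) = 2 * q - 1.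
  by rewrite -E !starM starK sq mulrA.
have svE : star v = (2 * q - 1) * (2 * P - 1) by rewrite vE starM ss sr.
have uq : unitary (2 * q - 1).
  suff h : (2 * q - 1) * (2 * q - 1) = 1 by split; rewrite ss.
  by rewrite -E !mulrA -(mulrA _ (star u)) u1 mulr1 -(mulrA u) qq mulr1.
have uv : unitary v by rewrite vE; apply: unitaryM => //; split; rewrite sr.
have [v1 v2] := uv.
have -> : P * u * Q * star u - q * P = 4^-1 *: (v - star v).
  rewrite svE vE -/(commutator _ _) commutatorZBl commutatorZBr !scalerA.
  have -> : 4^-1 * (2 * 2) = 1 :> R[i] by field.
  by rewrite scale1r /commutator /q !mulrA.
rewrite scalerA exprZn exprMn sqrCi mulN1r scaleNr -scalerN.
have -> : (4^-1) ^+ 2 = 16^-1 :> R[i] by field.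
congr (_ *: _); rewrite expr2 mulrBl !mulrBr v1 v2 -!expr2 /sin_sqr.
by rewrite !opprB (AC (2*2) (1*3*4*2)).
Qed.

(** (2 + 2 cos theta) (2 - 2 cos theta) = 4 sin(theta)^2. *)
Lemma cos_product w : unitary w ->
  (2 + w + star w) * (2 - (w + star w)) = sin_sqr w.
Proof.
move=> [w1 w2]; rewrite -addrA; set x := w + star w.
have -> : (2 + x) * (2 - x) = 4 - x * x.
  have c : 2 * x = x * 2 by rewrite mulr_natl mulr_natr.
  by rewrite mulrDl !mulrBr c addrA subrK -natrM.
rewrite /x mulrDl !mulrDr w1 w2 -!expr2 /sin_sqr.
have -> : 4 = 2 + 1 + 1 :> A by rewrite -!(natrD _ _ 1).
by rewrite !opprD (AC (3*(2*2)) ((1*4*7)*((2*5)*(3*6)))) /= !subrr !addr0.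
Qed.

End Final.

Theorem corollary2 (R : realType) (A : tracialWStarSpace R)
    (P Q : A) (U : R -> A) :
  orthogonal_projection P -> orthogonal_projection Q ->
  tau A P = 1 / 2 -> tau A Q = 1 / 2 ->
  free_unitary_brownian_motion U ->
  star_free [set U t | t in [set t : R | 0 <= t]] [set P; Q] ->
  let RP : A := 2 * P - 1 in
  let SQ : A := 2 * Q - 1 in
  let W (u : R) : A := RP * SQ * U u in
  forall t : R, 0 < t ->
  let C : A := 'i *: (P * U t * Q * star (U t) - U t * Q * star (U t) * P) in
  same_spectral_distribution (C ^+ 2)
    (16^-1 *: ((2 + W (2 * t) + star (W (2 * t))) *
               (2 - (W (2 * t) + star (W (2 * t)))))).
Proof.
move=> pP pQ tP tQ [U0 unitU [F [X [filtF bmX adU sdeU]]]] freeU RP SQ W t t0 C.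
have [sr rr r0] := projection_symmetry _ pP tP; have [sq qq q0] := projection_symmetry _ pQ tQ.
have t0' := ltW t0; have t20 : 0 <= 2 * t by rewrite mulr_ge0.
have sP := smallest_star_subalgebra [set P; Q].
have PP : smallest star_subalgebra [set P; Q] P by apply: mem_smallest_star; left.
have PQ : smallest star_subalgebra [set P; Q] Q by apply: mem_smallest_star; right.
have PR : smallest star_subalgebra [set P; Q] RP.
  by rewrite /RP mulr_natl mulr2n; apply: (ssubB _ sP); [exact: (ssubD _ sP)|exact: (ssub1 _ sP)].
have PS : smallest star_subalgebra [set P; Q] SQ.
  by rewrite /SQ mulr_natl mulr2n; apply: (ssubB _ sP); [exact: (ssubD _ sP)|exact: (ssub1 _ sP)].
have rateU := rate_power F X U filtF bmX adU sdeU unitU.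
pose V := RP * U t * SQ * star (U t).
have uR : unitary RP by split; rewrite sr.
have uS : unitary SQ by split; rewrite sq.
have uV : unitary V.
  by apply: unitaryM; [do 2!apply: unitaryM => //; exact: unitU|exact/unitary_star/unitU].
have uW : unitary (W (2 * t)) by apply: unitaryM; [exact: unitaryM|exact: unitU].
have moments n : tau A (V ^+ n) = tau A (W (2 * t) ^+ n).
  exact: (moments_conj_mul U [set P; Q]).
rewrite cos_product // /C commutator_sqr //; last exact: unitU.
rewrite -/RP -/SQ -/V.
have s16 x : star (16^-1 *: sin_sqr x) = 16^-1 *: sin_sqr x :> A.
  by rewrite starZ star_sin_sqr fmorphV rmorph_nat.
have mom n : tau A ((16^-1 *: sin_sqr V) ^+ n) =
    tau A ((16^-1 *: sin_sqr (W (2 * t))) ^+ n).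
  by rewrite !exprZn !tauZ (tau_sin_sqr V (W (2 * t))).
split; [exact: s16|exact: s16|exact: mom|].
by move=> mu; split=> -[_ H]; split; rewrite /self_adjoint ?s16 // => n;
  have [int_n mom_n] := H n; split=> //; rewrite -mom_n mom.
Qed.
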